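(* Let $S_1=\langle m_1,\dots,m_l\rangle$ and $S_2=\langle n_1,\dots,n_k\rangle$ be two numerical semigroups minimally generated by $m_1<\dots<m_l$ and $n_1<\dots<n_k$ respectively, and let $S=\langle qm_1,\dots,qm_l,pn_1,\dots,pn_k\rangle$ be a nice gluing of $S_1$ and $S_2$. Suppose that the local ring $K[[t^{m_1},\dots,t^{m_l}]]$ associated to the monomial curve $C_1=C(m_1,\dots,m_l)$ has a non-decreasing Hilbert function and that $C_2=C(n_1,\dots,n_k)$ has Cohen-Macaulay tangent cone at the origin. Then the Hilbert function of the local ring $K[[t^{qm_1},\dots,t^{qm_l},t^{pn_1},\dots,t^{pn_k}]]$ associated to the monomial curve $C=C(qm_1,\dots,qm_l,pn_1,\dots,pn_k)$ obtained by gluing is also non-decreasing.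
   Context: $K$ is an algebraically closed field. For positive integers $d_1,\dots,d_r$ with $\gcd(d_1,\dots,d_r)=1$, $\langle d_1,\dots,d_r\rangle=\{\sum_{i=1}^r a_id_i : a_i\in\mathbb{Z}_{\ge 0}\}$ is the numerical semigroup they generate; all numerical semigroups are taken with generators of gcd $1$. Monomial curves: if $d_1,\dots,d_r$ minimally generate a numerical semigroup, the affine monomial curve $C=C(d_1,\dots,d_r)\subset\mathbb{A}^r$ over $K$ is the curve with generic zero $(t^{d_1},\dots,t^{d_r})$; its defining ideal $I(C)\subset K[x_1,\dots,x_r]$ is the kernel of the $K$-algebra map $K[x_1,\dots,x_r]\to K[t]$, $x_i\mapsto t^{d_i}$. (For a glued curve $C(qm_1,\dots,qm_l,pn_1,\dots,pn_k)$ the generators are not required to be listed in increasing order.) Tangent cone: for a nonzero polynomial $f$, $f_*$ denotes its homogeneous summand of least degree, and $I(C)_*$ is the ideal generated by the $f_*$ for $0\ne f\in I(C)$. $I(C)_*$ is the defining ideal of the tangent cone of $C$ at the origin, and ''$C$ has Cohen-Macaulay tangent cone at the origin'' means that $K[x_1,\dots,x_r]/I(C)_*$ is a Cohen-Macaulay ring. Hilbert function: the local ring associated to $C$ is $R=K[[t^{d_1},\dots,t^{d_r}]]$ with maximal ideal $\mathfrak m$; its Hilbert function is $H_R(n)=\dim_K \mathfrak m^n/\mathfrak m^{n+1}$, $n\ge 0$, i.e. the Hilbert function of the associated graded ring $gr_{\mathfrak m}(R)\cong K[x_1,\dots,x_r]/I(C)_*$. It is non-decreasing if $H_R(n)\le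 H_R(n+1)$ for all $n\ge 0$. Gluing: let $S_1,S_2$ be numerical semigroups minimally generated by $m_1<\dots<m_l$ and $n_1<\dots<n_k$. Let $p=b_1m_1+\dots+b_lm_l\in S_1$ and $q=a_1n_1+\dots+a_kn_k\in S_2$ (with $a_i,b_j$ non-negative integers) be positive integers with $\gcd(p,q)=1$, $p\notin\{m_1,\dots,m_l\}$, $q\notin\{n_1,\dots,n_k\}$ and $\{qm_1,\dots,qm_l\}\cap\{pn_1,\dots,pn_k\}=\emptyset$. Then $S=\langle qm_1,\dots,qm_l,pn_1,\dots,pn_k\rangle$ is called a gluing of $S_1$ and $S_2$. It is called a nice gluing if moreover $p=b_1m_1+\dots+b_lm_l\in S_1$ and $q=a_1n_1\in S_2$ with $a_1\le b_1+\dots+b_l$. *)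

(* Defs.v *)
From HB Require Import structures.
From mathcomp Require Import all_boot all_order all_algebra.
From mathcomp Require Import boolp classical_sets.
From mathcomp Require Import mpoly ring.

Set Implicit Arguments.
Unset Strict Implicit.
Unset Printing Implicit Defensive.

Import GRing.Theory.

Local Open Scope classical_set_scope.
Local Open Scope ring_scope.
Local Open Scope quotient_scope.

Section Ideals.
Variable R : comPzRingType.
Implicit Types I J P A B : set R.

Definition is_ideal I : Prop :=
  [/\ I 0, forall x y, I x -> I y -> I (x + y) & forall a x, I x -> I (a * x)].

Definition is_prime_ideal P : Prop :=
  [/\ is_ideal P, ~ P 1 & forall x y, P (x * y) -> P x \/ P y].

Definition is_maximal_ideal I : Prop :=
  [/\ is_ideal I, ~ I 1 & forall J, is_ideal J -> ~ J 1 -> I `<=` J -> J = I].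

Definition gen_ideal A : set R := smallest is_ideal A.

Definition mul_ideal I J : set R := gen_ideal [set x * y | x in I & y in J].

Definition pow_ideal I n : set R := iter n (mul_ideal I) setT.

Definition noetherian : Prop :=
  forall I, is_ideal I -> exists s : seq R, I = gen_ideal [set` s].

Definition nonunits : set R := [set x | ~ exists y, x * y = 1].

(* The chain P_0 < ... < P_h has length h. *)
Definition prime_chain (h : nat) : Prop :=
  exists P : nat -> set R,
    (forall i, (i <= h)%N -> is_prime_ideal (P i)) /\
    (forall i, (i < h)%N -> P i `<` P i.+1).

Definition regular_seq (s : seq R) : Prop :=
  (forall i, (i < size s)%N ->
     forall a, gen_ideal [set` take i s] (s`_i * a) ->
               gen_ideal [set` take i s] a) /\
  ~ gen_ideal [set` s] 1.

Lemma gen_ideal_ideal A : is_ideal (gen_ideal A).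
Proof.
split=> [J [[]] //|x y Ix Iy J JA|a x Ix J JA].
  by case: (JA) => -[_ JD _] _; apply: JD; [apply: Ix|apply: Iy].
by case: (JA) => -[_ _ JM] _; apply: JM; apply: Ix.
Qed.

Lemma is_idealN I x : is_ideal I -> I x -> I (- x).
Proof. by case=> _ _ IM Ix; rewrite -mulN1r; apply: IM. Qed.

Lemma is_idealB I x y : is_ideal I -> I x -> I y -> I (x - y).
Proof.
by move=> II Ix Iy; case: (II) => _ ID _; apply: ID => //; apply: is_idealN.
Qed.

End Ideals.

Arguments noetherian R : clear implicits.
Arguments nonunits R : clear implicits.
Arguments prime_chain R : clear implicits.

(* [{ideal_quot I}] of ring_quotient only covers ideals bundled with a proof
   that they are proper. *)

Section RingQuot.
Variables (R : comPzRingType) (I : set R) (II : is_ideal I).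

Definition rq_equiv (x y : R) : bool := `[< I (x - y) >].

Lemma rq_equiv_class : equiv_class_of rq_equiv.
Proof.
have [I0 ID _] := II.
split=> [x|x y|y x z]; rewrite /rq_equiv.
- by rewrite subrr; apply/asboolP.
- by apply/asboolP/asboolP => /(is_idealN II); rewrite opprB.
- move=> /asboolP Ixy /asboolP Iyz; apply/asboolP.
  by rewrite -(subrK y x) -addrA; apply: ID.
Qed.

Canonical rq_equiv_equiv := EquivRelPack rq_equiv_class.
Canonical rq_encModRel := defaultEncModRel rq_equiv.

Definition ring_quot := {eq_quot rq_equiv}.

HB.instance Definition _ := EqQuotient.on ring_quot.
HB.instance Definition _ := Choice.on ring_quot.

Definition to_rq (x : R) : ring_quot := \pi_ring_quot x.

Lemma to_rqE x y : to_rq x = to_rq y <-> I (x - y).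
Proof.
split=> [/(@eqmodP _ rq_equiv_equiv)/asboolP //|Ixy].
by apply/(@eqmodP _ rq_equiv_equiv)/asboolP.
Qed.

Lemma rq_reprK u : to_rq (repr u) = u. Proof. exact: reprK. Qed.

Definition rq_add (u v : ring_quot) := to_rq (repr u + repr v).
Definition rq_opp (u : ring_quot) := to_rq (- repr u).
Definition rq_mul (u v : ring_quot) := to_rq (repr u * repr v).

Lemma rq_repr x : I (repr (to_rq x) - x).
Proof. by apply/to_rqE; rewrite rq_reprK. Qed.

Lemma to_rqD x y : rq_add (to_rq x) (to_rq y) = to_rq (x + y).
Proof.
apply/to_rqE; rewrite opprD addrACA.
by have [_ ID _] := II; apply: ID; apply: rq_repr.
Qed.

Lemma to_rqN x : rq_opp (to_rq x) = to_rq (- x).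
Proof. by apply/to_rqE; rewrite -opprD; apply: is_idealN => //; apply: rq_repr. Qed.

Lemma to_rqM x y : rq_mul (to_rq x) (to_rq y) = to_rq (x * y).
Proof.
apply/to_rqE; have [_ ID IM] := II.
set x' := repr _; set y' := repr _.
have -> : x' * y' - x * y = y' * (x' - x) + x * (y' - y) by ring.
by apply: ID; apply: IM; apply: rq_repr.
Qed.

Lemma rq_addA : associative rq_add.
Proof.
move=> u v w; rewrite -(rq_reprK u) -(rq_reprK v) -(rq_reprK w).
by rewrite !to_rqD addrA.
Qed.

Lemma rq_addC : commutative rq_add.
Proof. by move=> u v; rewrite /rq_add addrC. Qed.

Lemma rq_add0 : left_id (to_rq 0) rq_add.
Proof. by move=> u; rewrite -(rq_reprK u) to_rqD add0r. Qed.

Lemma rq_addN : left_inverse (to_rq 0) rq_opp rq_add.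
Proof. by move=> u; rewrite -(rq_reprK u) to_rqN to_rqD addNr. Qed.

HB.instance Definition _ :=
  GRing.isZmodule.Build ring_quot rq_addA rq_addC rq_add0 rq_addN.

Lemma rq_mulA : associative rq_mul.
Proof.
move=> u v w; rewrite -(rq_reprK u) -(rq_reprK v) -(rq_reprK w).
by rewrite !to_rqM mulrA.
Qed.

Lemma rq_mulC : commutative rq_mul.
Proof. by move=> u v; rewrite /rq_mul mulrC. Qed.

Lemma rq_mul1 : left_id (to_rq 1) rq_mul.
Proof. by move=> u; rewrite -(rq_reprK u) to_rqM mul1r. Qed.

Lemma rq_mulDl : left_distributive rq_mul +%R.
Proof.
move=> u v w; rewrite -(rq_reprK u) -(rq_reprK v) -(rq_reprK w).
by rewrite /GRing.add /= /Algebra.add /= to_rqD !to_rqM to_rqD mulrDl.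
Qed.

HB.instance Definition _ := GRing.Zmodule_isComPzRing.Build ring_quot
  rq_mulA rq_mulC rq_mul1 rq_mulDl.

End RingQuot.

Section Localization.
Variables (R : comPzRingType) (P : set R) (PP : is_prime_ideal P).

Definition loc_den := {s : R | `[< ~ P s >]}.

Definition loc_equiv (x y : R * loc_den) : bool :=
  `[< exists u, ~ P u /\ u * (x.1 * sval y.2 - y.1 * sval x.2) = 0 >].

Lemma loc_denP (s : loc_den) : ~ P (sval s).
Proof. by case: s => s /= /asboolP. Qed.

Lemma loc_notP1 : ~ P 1. Proof. by have [] := PP. Qed.

Lemma loc_notPM x y : ~ P x -> ~ P y -> ~ P (x * y).
Proof. by have [_ _ PM] := PP => Px Py /PM[]. Qed.

Lemma loc_equiv_class : equiv_class_of loc_equiv.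
Proof.
split=> [x|x y|y x z]; rewrite /loc_equiv.
- by apply/asboolP; exists 1; rewrite subrr mulr0; split=> //; apply: loc_notP1.
- apply/asboolP/asboolP => -[u [Pu e]]; exists u; split=> //.
    by rewrite -opprB mulrN e oppr0.
  by rewrite -opprB mulrN e oppr0.
- move=> /asboolP[u [Pu e]] /asboolP[v [Pv f]]; apply/asboolP.
  exists (u * v * sval y.2); split.
    by apply: loc_notPM; [apply: loc_notPM|apply: loc_denP].
  transitivity (v * sval z.2 * (u * (x.1 * sval y.2 - y.1 * sval x.2)) +
                u * sval x.2 * (v * (y.1 * sval z.2 - z.1 * sval y.2))).
    by ring.
  by rewrite e f !mulr0 addr0.
Qed.

Canonical loc_equiv_equiv := EquivRelPack loc_equiv_class.
Canonical loc_encModRel := defaultEncModRel loc_equiv.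

Definition localization := {eq_quot loc_equiv}.

HB.instance Definition _ := EqQuotient.on localization.
HB.instance Definition _ := Choice.on localization.

Definition loc_one : loc_den := exist _ 1 (asboolT loc_notP1).
Definition loc_mulden (s t : loc_den) : loc_den :=
  exist _ (sval s * sval t) (asboolT (loc_notPM (loc_denP (s := s)) (loc_denP (s := t)))).

Definition loc_frac (x : R) (s : loc_den) : localization := \pi_localization (x, s).

Lemma loc_fracE x s y t : loc_frac x s = loc_frac y t <->
  exists u, ~ P u /\ u * (x * sval t - y * sval s) = 0.
Proof.
split=> [/(@eqmodP _ loc_equiv_equiv)/asboolP //|e].
by apply/(@eqmodP _ loc_equiv_equiv)/asboolP.
Qed.

Lemma loc_frac_repr u : loc_frac (repr u).1 (repr u).2 = u.
Proof. by rewrite /loc_frac -surjective_pairing reprK. Qed.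

Definition loc_add (u v : localization) :=
  loc_frac ((repr u).1 * sval (repr v).2 + (repr v).1 * sval (repr u).2)
       (loc_mulden (repr u).2 (repr v).2).
Definition loc_opp (u : localization) := loc_frac (- (repr u).1) (repr u).2.
Definition loc_mul (u v : localization) :=
  loc_frac ((repr u).1 * (repr v).1) (loc_mulden (repr u).2 (repr v).2).

Lemma loc_fracD x s y t :
  loc_add (loc_frac x s) (loc_frac y t) =
  loc_frac (x * sval t + y * sval s) (loc_mulden s t).
Proof.
have /loc_fracE[u [Pu e]] := loc_frac_repr (loc_frac x s).
have /loc_fracE[v [Pv f]] := loc_frac_repr (loc_frac y t).
apply/loc_fracE; exists (u * v); split; first exact: loc_notPM.
move: e f; rewrite /=.
set a := (repr (loc_frac x s)).1; set b := (repr (loc_frac y t)).1.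
set c := sval (repr (loc_frac x s)).2; set d := sval (repr (loc_frac y t)).2 => e f.
transitivity (v * d * sval t * (u * (a * sval s - x * c)) +
              u * c * sval s * (v * (b * sval t - y * d))).
  by ring.
by rewrite e f !mulr0 addr0.
Qed.

Lemma loc_fracN x s : loc_opp (loc_frac x s) = loc_frac (- x) s.
Proof.
have /loc_fracE[u [Pu e]] := loc_frac_repr (loc_frac x s).
apply/loc_fracE; exists u; split=> //.
by rewrite !mulNr -opprD mulrN e oppr0.
Qed.

Lemma loc_fracM x s y t :
  loc_mul (loc_frac x s) (loc_frac y t) = loc_frac (x * y) (loc_mulden s t).
Proof.
have /loc_fracE[u [Pu e]] := loc_frac_repr (loc_frac x s).
have /loc_fracE[v [Pv f]] := loc_frac_repr (loc_frac y t).
apply/loc_fracE; exists (u * v); split; first exact: loc_notPM.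
move: e f; rewrite /=.
set a := (repr (loc_frac x s)).1; set b := (repr (loc_frac y t)).1.
set c := sval (repr (loc_frac x s)).2; set d := sval (repr (loc_frac y t)).2 => e f.
transitivity (v * b * sval t * (u * (a * sval s - x * c)) +
              u * x * c * (v * (b * sval t - y * d))).
  by ring.
by rewrite e f !mulr0 addr0.
Qed.

Lemma eq_loc_frac x s y t : x * sval t = y * sval s -> loc_frac x s = loc_frac y t.
Proof.
move=> e; apply/loc_fracE; exists 1; split; first exact: loc_notP1.
by rewrite e subrr mulr0.
Qed.

Lemma loc_addA : associative loc_add.
Proof.
move=> u v w; rewrite -(loc_frac_repr u) -(loc_frac_repr v) -(loc_frac_repr w) !loc_fracD.
by apply: eq_loc_frac => /=; ring.
Qed.

Lemma loc_addC : commutative loc_add.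
Proof.
move=> u v; rewrite -(loc_frac_repr u) -(loc_frac_repr v) !loc_fracD.
by apply: eq_loc_frac => /=; ring.
Qed.

Lemma loc_add0 : left_id (loc_frac 0 loc_one) loc_add.
Proof.
by move=> u; rewrite -(loc_frac_repr u) loc_fracD; apply: eq_loc_frac => /=; ring.
Qed.

Lemma loc_addN : left_inverse (loc_frac 0 loc_one) loc_opp loc_add.
Proof.
move=> u; rewrite -(loc_frac_repr u) loc_fracN loc_fracD.
by apply: eq_loc_frac => /=; ring.
Qed.

HB.instance Definition _ :=
  GRing.isZmodule.Build localization loc_addA loc_addC loc_add0 loc_addN.

Lemma loc_mulA : associative loc_mul.
Proof.
move=> u v w; rewrite -(loc_frac_repr u) -(loc_frac_repr v) -(loc_frac_repr w) !loc_fracM.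
by apply: eq_loc_frac => /=; ring.
Qed.

Lemma loc_mulC : commutative loc_mul.
Proof.
move=> u v; rewrite -(loc_frac_repr u) -(loc_frac_repr v) !loc_fracM.
by apply: eq_loc_frac => /=; ring.
Qed.

Lemma loc_mul1 : left_id (loc_frac 1 loc_one) loc_mul.
Proof.
by move=> u; rewrite -(loc_frac_repr u) loc_fracM; apply: eq_loc_frac => /=; ring.
Qed.

Lemma loc_mulDl : left_distributive loc_mul loc_add.
Proof.
move=> u v w; rewrite -(loc_frac_repr u) -(loc_frac_repr v) -(loc_frac_repr w).
rewrite loc_fracD !loc_fracM loc_fracD.
by apply: eq_loc_frac => /=; ring.
Qed.

HB.instance Definition _ := GRing.Zmodule_isComPzRing.Build localization
  loc_mulA loc_mulC loc_mul1 loc_mulDl.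

End Localization.

Definition is_max_nat (L : nat -> Prop) (d : nat) : Prop :=
  L d /\ forall e, L e -> (e <= d)%N.

Definition has_krull_dim (A : comPzRingType) : nat -> Prop :=
  is_max_nat (prime_chain A).

Definition is_local (A : comPzRingType) : Prop := is_ideal (nonunits A).

Definition has_depth (A : comPzRingType) : nat -> Prop :=
  is_max_nat (fun h => exists s : seq A,
    [/\ size s = h, [set` s] `<=` nonunits A & regular_seq s]).

Definition cohen_macaulay_local (A : comPzRingType) : Prop :=
  [/\ is_local A, noetherian A & exists d, has_krull_dim A d /\ has_depth A d].

Definition cohen_macaulay (A : comPzRingType) : Prop :=
  noetherian A /\
  forall (P : set A) (PP : is_prime_ideal P),
    is_maximal_ideal P -> cohen_macaulay_local (localization PP).

(* Meant for subspaces [U `<=` W] of V: the classes of the [e i] are a basis of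
   W / U. *)
Definition is_basis_mod (K : fieldType) (V : lmodType K) (W U : set V)
    (d : nat) (e : 'I_d -> V) : Prop :=
  [/\ forall i, W (e i),
      forall c : 'I_d -> K, U (\sum_i c i *: e i) -> forall i, c i = 0 &
      forall w, W w -> exists c : 'I_d -> K, U (w - \sum_i c i *: e i)].

(* Junk value 0 when W / U is not finite dimensional. *)
Definition quot_dim (K : fieldType) (V : lmodType K) (W U : set V) : nat :=
  xget 0%N [set d | exists e : 'I_d -> V, is_basis_mod W U e].

(* In a local ring the maximal ideal is the set of nonunits. *)
Definition hilbert_function (K : fieldType) (A : comAlgType K) (n : nat) : nat :=
  quot_dim (pow_ideal (nonunits A) n) (pow_ideal (nonunits A) n.+1).

Definition nondecreasing_hilbert (K : fieldType) (A : comAlgType K) : Prop :=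
  forall n, (hilbert_function A n <= hilbert_function A n.+1)%N.

(* The ring K[[t]] of formal power series. *)
Record fps (K : fieldType) := Fps { fcoef :> nat -> K }.

Section PowerSeries.
Variable K : fieldType.
Implicit Types f g h : fps K.

HB.instance Definition _ := gen_eqMixin (fps K).
HB.instance Definition _ := gen_choiceMixin (fps K).

Lemma fpsP f g : f =1 g -> f = g.
Proof. by case: f g => [f] [g] /= e; congr Fps; apply/funext. Qed.

Definition fps_add f g := Fps (fun n => f n + g n).
Definition fps_opp f := Fps (fun n => - f n).
Definition fps_zero : fps K := Fps (fun=> 0).
Definition fps_one : fps K := Fps (fun n => (n == 0%N)%:R).
Definition fps_mul f g := Fps (fun n => \sum_(i < n.+1) f i * g (n - i)%N).
Definition fps_scale (a : K) f := Fps (fun n => a * f n).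

Lemma fps_addA : associative fps_add.
Proof. by move=> f g h; apply: fpsP => n /=; rewrite addrA. Qed.
Lemma fps_addC : commutative fps_add.
Proof. by move=> f g; apply: fpsP => n /=; rewrite addrC. Qed.
Lemma fps_add0 : left_id fps_zero fps_add.
Proof. by move=> f; apply: fpsP => n /=; rewrite add0r. Qed.
Lemma fps_addN : left_inverse fps_zero fps_opp fps_add.
Proof. by move=> f; apply: fpsP => n /=; rewrite addNr. Qed.

HB.instance Definition _ :=
  GRing.isZmodule.Build (fps K) fps_addA fps_addC fps_add0 fps_addN.

Let trunc n f : {poly K} := \poly_(i < n.+1) f i.

Let truncE n f i : (i <= n)%N -> (trunc n f)`_i = f i.
Proof. by move=> le_in; rewrite coef_poly ltnS le_in. Qed.

Let fps_mul_trunc n f g i :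
  (i <= n)%N -> (trunc n f * trunc n g)`_i = fps_mul f g i.
Proof.
move=> le_in; rewrite coefM /=; apply: eq_bigr => j _.
by rewrite !truncE // ?(leq_trans (leq_subr _ _)) // (leq_trans _ le_in) // -ltnS.
Qed.

Lemma fps_mulC : commutative fps_mul.
Proof.
by move=> f g; apply: fpsP => n; rewrite -!(@fps_mul_trunc n) // mulrC.
Qed.

Lemma fps_mulA : associative fps_mul.
Proof.
move=> f g h; apply: fpsP => n.
transitivity ((trunc n f * (trunc n g * trunc n h))`_n).
  rewrite coefM; apply: eq_bigr => i _.
  by rewrite fps_mul_trunc ?leq_subr // truncE // -ltnS.
rewrite mulrA coefM; apply: eq_bigr => i _.
have le_in : (i <= n)%N by rewrite -ltnS.
by rewrite fps_mul_trunc // truncE ?leq_subr.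
Qed.

Lemma fps_mul1 : left_id fps_one fps_mul.
Proof.
move=> f; apply: fpsP => n /=; rewrite big_ord_recl /= mul1r subn0.
by rewrite big1 ?addr0 // => i _; rewrite mul0r.
Qed.

Lemma fps_mulDl : left_distributive fps_mul +%R.
Proof.
move=> f g h; apply: fpsP => n /=; rewrite -big_split /=.
by apply: eq_bigr => i _; rewrite mulrDl.
Qed.

Lemma fps_1neq0 : fps_one != 0.
Proof.
by apply/eqP => /(congr1 (fun f => fcoef f 0%N)) /= /eqP; rewrite oner_eq0.
Qed.

HB.instance Definition _ := GRing.Zmodule_isComNzRing.Build (fps K)
  fps_mulA fps_mulC fps_mul1 fps_mulDl fps_1neq0.

Lemma fps_scaleA a b f : fps_scale a (fps_scale b f) = fps_scale (a * b) f.
Proof. by apply: fpsP => n /=; rewrite mulrA. Qed.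
Lemma fps_scale1 : left_id 1 fps_scale.
Proof. by move=> f; apply: fpsP => n /=; rewrite mul1r. Qed.
Lemma fps_scaleDr : right_distributive fps_scale +%R.
Proof. by move=> a f g; apply: fpsP => n /=; rewrite mulrDr. Qed.
Lemma fps_scaleDl f : {morph fps_scale^~ f : a b / a + b}.
Proof. by move=> a b; apply: fpsP => n /=; rewrite mulrDl. Qed.

HB.instance Definition _ := GRing.Zmodule_isLmodule.Build K (fps K)
  fps_scaleA fps_scale1 fps_scaleDr fps_scaleDl.

Lemma fps_scaleAl a f g : a *: (f * g) = (a *: f) * g.
Proof.
by apply: fpsP => n /=; rewrite mulr_sumr; apply: eq_bigr => i _; rewrite mulrA.
Qed.

HB.instance Definition _ := GRing.Lmodule_isLalgebra.Build K (fps K) fps_scaleAl.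
HB.instance Definition _ := GRing.Lalgebra_isComAlgebra.Build K (fps K).

End PowerSeries.

Definition semigroup (d : seq nat) : set nat :=
  [set s | exists a : 'I_(size d) -> nat,
     s = (\sum_(i < size d) a i * nth 0 d i)%N].

Definition min_generated_numsgp (d : seq nat) : Prop :=
  [/\ all (leq 1) d, \big[gcdn/0]_(x <- d) x = 1%N &
      forall d', subseq d' d -> semigroup d' = semigroup d -> d' = d].

Section LocalRing.
Variables (K : fieldType) (d : seq nat).

Definition weight (e : 'X_{1..size d}) : nat :=
  (\sum_(i < size d) e i * nth 0 d i)%N.

(* The image of K[[x_1, ..., x_r]] under x_i |-> t^d_i: the coefficient of t^n
   is the sum of the coefficients of the monomials of weight n, all of which
   have degree at most n since the d_i are positive. *)
Definition in_psring (f : fps K) : Prop :=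
  exists g : 'X_{1..size d} -> K,
    forall n, f n = \sum_(e : bmultinom (size d) n.+1 | weight e == n) g e.

Definition psring_pred : {pred fps K} := fun f => `[< in_psring f >].

Lemma semigroupP s : semigroup d s <->
  exists e : 'X_{1..size d}, (mdeg e <= s)%N /\ weight e = s.
Proof.
split=> [[a ->]|[e [_ <-]]]; last by exists (fun i => e i).
pose e := [multinom if nth 0%N d i == 0%N then 0%N else a i | i < size d].
have we : weight e = (\sum_(i < size d) a i * nth 0 d i)%N.
  by apply: eq_bigr => i _; rewrite mnmE; case: eqP => [->|//]; rewrite !muln0.
exists e; split=> //; rewrite -we mdegE; apply: leq_sum => i _.
by rewrite mnmE; case: eqP => // /eqP; rewrite -lt0n => h; rewrite leq_pmulr.
Qed.

Lemma in_psringP f : in_psring f <-> forall n, f n != 0 -> semigroup d n.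
Proof.
split=> [[g fE] n|fS].
  apply: contra_neqP => nSn; rewrite fE big1 // => e /eqP we.
  by case: nSn; exists (fun i => (e : 'X_{1..size d}) i).
pose W n := [set e : 'X_{1..size d} | (mdeg e <= n)%N /\ weight e = n].
pose E n := xget 0%MM (W n).
exists (fun e => if e == E (weight e) then f (weight e) else 0) => n.
have [fn0|/fS/semigroupP Sn] := eqVneq (f n) 0.
  by rewrite big1 // => e /eqP ->; rewrite fn0 if_same.
have [En wn] : (mdeg (E n) <= n)%N /\ weight (E n) = n.
  by case: Sn => e We; exact: (@xgetI _ 0%MM (W n) e We).
have ltE : (mdeg (E n) < n.+1)%N by [].
rewrite (bigD1 (BMultinom ltE)) /= ?wn // eqxx big1 ?addr0 // => e.
case/andP=> /eqP -> eE; case: eqP => // e_E.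
by case/eqP: eE; apply: val_inj.
Qed.

Lemma psring_subalg_closed : GRing.subalg_closed psring_pred.
Proof.
have PE f : (f \in psring_pred) <-> forall n, f n != 0 -> semigroup d n.
  by rewrite -in_psringP; split=> [/asboolP|/asboolP].
have S0 : semigroup d 0 by exists (fun=> 0%N); rewrite big1.
have SD s t : semigroup d s -> semigroup d t -> semigroup d (s + t)%N.
  move=> [a ->] [b ->]; exists (fun i => a i + b i)%N.
  by rewrite -big_split /=; apply: eq_bigr => i _; rewrite mulnDl.
split.
- by apply/PE => -[|n] //=; rewrite eqxx.
- move=> a f g /PE fS /PE gS; apply/PE => n /=.
  have [fn0|/fS//] := eqVneq (f n) 0.
  by have [gn0|/gS//] := eqVneq (g n) 0; rewrite fn0 gn0 mulr0 addr0 eqxx.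
- move=> f g /PE fS /PE gS; apply/PE => n /=; apply: contra_neqP => nSn.
  rewrite big1 // => i _.
  have [->|/fS Si] := eqVneq (f i) 0; first by rewrite mul0r.
  have [->|/gS Sni] := eqVneq (g (n - i)%N) 0; first by rewrite mulr0.
  by case: nSn; rewrite -(subnKC (ltn_ord i : (i <= n)%N)); apply: SD.
Qed.

HB.instance Definition _ :=
  GRing.isSubalgClosed.Build K (fps K) psring_pred
    (GRing.subalg_closed_semi psring_subalg_closed).

(* K[[t^d_1, ..., t^d_r]] as a subalgebra of K[[t]]. *)
Record psring := PSRing { psval :> fps K; _ : psval \in psring_pred }.

HB.instance Definition _ := [isSub for psval].
HB.instance Definition _ := [Choice of psring by <:].
HB.instance Definition _ := [SubChoice_isSubComNzRing of psring by <:].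
HB.instance Definition _ := [SubZmodule_isSubLmodule of psring by <:].
HB.instance Definition _ := [SubNzRing_SubLmodule_isSubLalgebra of psring by <:].
HB.instance Definition _ := GRing.Lalgebra_isComAlgebra.Build K psring.

End LocalRing.

Section TangentCone.
Variables (K : fieldType) (d : seq nat).

Definition curve_ideal : set {mpoly K[size d]} :=
  [set f | mmap (@polyC K) (fun i : 'I_(size d) => 'X^(nth 0%N d i)) f = 0].

(* Every monomial of f has degree less than [msize f], so this is the least
   degree of a monomial of f when f != 0. *)
Definition min_deg r (f : {mpoly K[r]}) : nat :=
  \big[minn/msize f]_(m <- msupp f) mdeg m.
Definition init_form r (f : {mpoly K[r]}) : {mpoly K[r]} :=
  pihomog mdeg (min_deg f) f.

Definition tangent_cone_ideal : set {mpoly K[size d]} :=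
  gen_ideal [set init_form f | f in curve_ideal `\ 0].

Definition tangent_cone_ring : comPzRingType :=
  ring_quot (I := tangent_cone_ideal) (gen_ideal_ideal _).

Definition cm_tangent_cone : Prop := cohen_macaulay tangent_cone_ring.

End TangentCone.

Definition glue (p q : nat) (m n : seq nat) : seq nat :=
  [seq (q * x)%N | x <- m] ++ [seq (p * x)%N | x <- n].

Definition is_gluing (p q : nat) (m n : seq nat) : Prop :=
  [/\ semigroup m p, semigroup n q, (0 < p)%N && (0 < q)%N, coprime p q &
      [/\ p \notin m, q \notin n &
          ~~ has (mem [seq (q * x)%N | x <- m]) [seq (p * x)%N | x <- n]]].

Definition is_nice_gluing (p q : nat) (m n : seq nat) : Prop :=
  is_gluing p q m n /\
  exists (b : 'I_(size m) -> nat) (a1 : nat),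
    [/\ p = (\sum_(j < size m) b j * nth 0 m j)%N, q = (a1 * nth 0 n 0)%N &
        (a1 <= \sum_(j < size m) b j)%N].

(* Main.v *)
Require Import Defs.
From mathcomp Require Import all_boot all_algebra.
From mathcomp Require Import boolp classical_sets mpoly zify.

(* For s in a numerical semigroup S, let ord s be the largest number of
   generators that sum to s. The power m^k of the maximal ideal of K[[S]]
   consists of the series supported in {ord >= k}, so the Hilbert function
   counts H(k) = #{s in S | ord s = k}.

   Let x = min n. If the tangent cone of C_2 is Cohen-Macaulay, then
   ord (x + s) = ord s + 1 on S_2: otherwise some nonzero monomial t^s of the
   tangent cone is killed by x; the other variables are nilpotent there, so a
   nonzero monomial multiple of t^s is killed by the whole irrelevant maximal
   ideal. The depth at the origin is then 0, although the dimension is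
   positive.

   Every element of the glued semigroup is uniquely q u + p v with u in S_1 and
   v in the Apery set of S_2 with respect to q. Since q = a x and p has a
   factorization in S_1 of length b >= a, moving q from v to u does not shorten
   factorizations, whence ord (q u + p v) = ord u + ord v. So H is a sum of
   shifts of the Hilbert function of C_1. *)

Set Implicit Arguments.
Unset Strict Implicit.
Unset Printing Implicit Defensive.

Import GRing.Theory.

(** * Longest factorizations in a numerical semigroup *)

Fixpoint sum_of (d : seq nat) (k s : nat) : bool :=
  if k is k'.+1 then has (fun x => (x <= s) && sum_of d k' (s - x)) d
  else s == 0.

(** A sum of k positive generators is at least k, so lengths up to s suffice; [insgP] drops the
    bound. *)
Definition insg d s := [exists k : 'I_s.+1, sum_of d k s].
Definition ord d s := \max_(k < s.+1 | sum_of d k s) k.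
(** By [sum_of_bound] the range contains every element of order k. *)
Definition level d k :=
  [seq s <- iota 0 (k * \max_(x <- d) x).+1 | insg d s & ord d s == k].

Section SumOf.
Variable d : seq nat.

Lemma sum_ofS x k s : x \in d -> sum_of d k s -> sum_of d k.+1 (x + s).
Proof.
by move=> xd sk; apply/hasP; exists x => //; rewrite leq_addr addKn.
Qed.

Lemma sum_ofSP k s : sum_of d k.+1 s ->
  exists x t, [/\ x \in d, sum_of d k t & s = x + t].
Proof. by case/hasP=> x xd /andP[le_xs sk]; exists x, (s - x); rewrite subnKC. Qed.

Lemma sum_of1 x : x \in d -> sum_of d 1 x.
Proof. by move=> xd; rewrite -[x]addn0; apply: sum_ofS. Qed.

Lemma sum_ofD k1 k2 s1 s2 :
  sum_of d k1 s1 -> sum_of d k2 s2 -> sum_of d (k1 + k2) (s1 + s2).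
Proof.
elim: k1 s1 => [s1 /eqP-> //|k1 IH s1 /sum_ofSP[x [t [xd kt ->]]] k2s2].
by rewrite addSn -addnA; apply: sum_ofS => //; apply: IH.
Qed.

Lemma sum_ofM a k s : sum_of d k s -> sum_of d (a * k) (a * s).
Proof. by move=> sk; elim: a => // a IH; rewrite !mulSn; apply: sum_ofD. Qed.

Lemma sum_of_lincomb (a : 'I_(size d) -> nat) :
  sum_of d (\sum_i a i) (\sum_(i < size d) a i * nth 0 d i).
Proof.
apply: (big_ind2 (fun k s => sum_of d k s)) => // [*|i _]; first exact: sum_ofD.
by rewrite -{1}[a i]muln1; apply: sum_ofM; apply/sum_of1/mem_nth.
Qed.

Lemma sum_of_bound k s : sum_of d k s -> s <= k * \max_(x <- d) x.
Proof.
elim: k s => [s /eqP-> //|k IH s /sum_ofSP[x [t [xd kt ->]]]].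
by rewrite mulSn leq_add ?IH // (@leq_bigmax_seq _ d predT id).
Qed.

Local Notation weight := (@weight d).

Lemma weightD (e f : 'X_{1..size d}) : weight (e + f)%MM = weight e + weight f.
Proof.
by rewrite /weight -big_split; apply: eq_bigr => i _; rewrite mnmDE mulnDl.
Qed.

Lemma weight1 i : weight U_(i)%MM = nth 0 d i.
Proof.
rewrite /weight (bigD1 i) //= mnm1E eqxx mul1n big1 ?addn0 // => j.
by rewrite mnm1E eq_sym => /negPf->.
Qed.

Lemma sum_of_weight (e : 'X_{1..size d}) : sum_of d (mdeg e) (weight e).
Proof. by rewrite mdegE; apply: sum_of_lincomb. Qed.

Lemma sum_of_multinom k s : sum_of d k s ->
  exists e : 'X_{1..size d}, mdeg e = k /\ weight e = s.
Proof.
elim: k s => [s /eqP->|k IH s /sum_ofSP[x [t [xd /IH[e [<- <-]] ->]]]].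
  exists 0%MM; rewrite mdeg0 /weight big1 // => i _; rewrite mnm0E //.
have lt_xd : index x d < size d by rewrite index_mem.
exists (U_(Ordinal lt_xd) + e)%MM.
by rewrite mdegD mdeg1 weightD weight1 /= nth_index.
Qed.

Hypothesis d_gt0 : all (leq 1) d.

Lemma sum_of_leq k s : sum_of d k s -> k <= s.
Proof.
elim: k s => // k IH s /sum_ofSP[x [t [/(allP d_gt0) x_gt0 /IH le_kt ->]]].
by rewrite -add1n leq_add.
Qed.

Lemma insgP s : reflect (exists k, sum_of d k s) (insg d s).
Proof.
apply: (iffP existsP) => [[k sk]|[k sk]]; first by exists k.
by have lt_ks : k < s.+1 by [rewrite ltnS sum_of_leq]; exists (Ordinal lt_ks).
Qed.

Lemma sum_of_leq_ord k s : sum_of d k s -> k <= ord d s.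
Proof.
move=> sk; have lt_ks : k < s.+1 by rewrite ltnS sum_of_leq.
by rewrite (bigmax_sup (Ordinal lt_ks)).
Qed.

Lemma sum_of_ord s : insg d s -> sum_of d (ord d s) s.
Proof.
case/existsP=> k sk; have := @eq_bigmax_cond _ (fun k : 'I_s.+1 => sum_of d k s)
  (fun k => k : nat); rewrite -/(ord d s).
by case=> [|i si ->//]; apply/card_gt0P; exists k.
Qed.

Lemma insgE s : insg d s <-> semigroup d s.
Proof.
split=> [/insgP[k /sum_of_multinom[e [_ <-]]]|[a ->]]; first by exists e.
by apply/insgP; exists (\sum_i a i); apply: sum_of_lincomb.
Qed.

Lemma insgD s t : insg d s -> insg d t -> insg d (s + t).
Proof.
move=> /insgP[k sk] /insgP[l tl]; apply/insgP; exists (k + l); exact: sum_ofD.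
Qed.

Lemma leq_ordD s t : insg d s -> insg d t -> ord d s + ord d t <= ord d (s + t).
Proof. by move=> Ss St; apply/sum_of_leq_ord/sum_ofD; apply: sum_of_ord. Qed.

Lemma mem_level k s : (s \in level d k) = insg d s && (ord d s == k).
Proof.
rewrite mem_filter mem_iota andbC /= add0n ltnS.
case: (boolP (insg d s)) => /= [Ss|_].
  by case: eqP => [<-|]; rewrite ?andbF // andbT sum_of_bound // sum_of_ord.
by rewrite andbF.
Qed.

Lemma level_uniq k : uniq (level d k).
Proof. exact/filter_uniq/iota_uniq. Qed.
End SumOf.

(** * Gluing *)

(** The test [q <= v] guards against truncated subtraction, which would send v < q to 0, an element
    of the semigroup. *)
Definition in_apery d q v := insg d v && ~~ ((q <= v) && insg d (v - q)).

Section Gluing.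
Variables (m n : seq nat) (p q : nat).

Lemma sum_of_glue k l u v :
  sum_of m k u -> sum_of n l v -> sum_of (glue p q m n) (k + l) (q * u + p * v).
Proof.
move=> ku lv; apply: sum_ofD.
  elim: k u ku => [u /eqP->|k IH u /sum_ofSP[x [t [xm kt ->]]]].
    by rewrite muln0.
  by rewrite mulnDr; apply: sum_ofS; [rewrite mem_cat map_f|apply: IH].
elim: l v lv => [v /eqP->|l IH v /sum_ofSP[x [t [xn lt ->]]]].
  by rewrite muln0.
by rewrite mulnDr; apply: sum_ofS; [rewrite mem_cat map_f ?orbT|apply: IH].
Qed.

Lemma sum_of_glueP k s : sum_of (glue p q m n) k s ->
  exists k1 u k2 v,
    [/\ k = k1 + k2, s = q * u + p * v, sum_of m k1 u & sum_of n k2 v].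
Proof.
elim: k s => [s /eqP->|k IH s /sum_ofSP[x [t [xd /IH]]]].
  by exists 0, 0, 0, 0; rewrite !muln0.
case=> k1 [u [k2 [v [-> -> k1u k2v ->]]]].
move: xd; rewrite mem_cat => /orP[/mapP[y ym ->]|/mapP[y yn ->]].
  by exists k1.+1, (y + u), k2, v; split=> //; [lia|apply: sum_ofS].
by exists k1, u, k2.+1, (y + v); split=> //; [lia|lia|apply: sum_ofS].
Qed.

Hypotheses (m_gt0 : all (leq 1) m) (n_gt0 : all (leq 1) n).
Hypotheses (p_gt0 : 0 < p) (q_gt0 : 0 < q) (co_pq : coprime p q).
(** The data of a nice gluing: x stands for the first generator of n, and [ord_addx] is what the
    Cohen-Macaulay hypothesis will supply. *)
Variables (x a b : nat).
Hypotheses (pE : sum_of m b p) (xn : x \in n) (qE : q = a * x) (le_ab : a <= b).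
Hypothesis ord_addx : forall v, insg n v -> ord n (x + v) = (ord n v).+1.

Local Notation mn := (glue p q m n).

Lemma glue_gt0 : all (leq 1) mn.
Proof.
rewrite all_cat; apply/andP; split; apply/allP => _ /mapP[y yd ->].
  by rewrite muln_gt0 q_gt0; apply: (allP m_gt0).
by rewrite muln_gt0 p_gt0; apply: (allP n_gt0).
Qed.

Lemma insg_gluing : insg n q.
Proof. by apply/insgP => //; exists (a * 1); rewrite qE; apply/sum_ofM/sum_of1. Qed.

Lemma ord_addq v : insg n v -> ord n (q + v) = a + ord n v.
Proof.
rewrite qE => Sv.
suff [] : insg n (a * x + v) /\ ord n (a * x + v) = a + ord n v by [].
elim: a => // c [IHS IH]; rewrite mulSn -addnA ord_addx // IH; split=> //.
by apply: insgD => //; apply/insgP => //; exists 1; apply: sum_of1.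
Qed.

(* Trading a summand q of v for p copies of q in u does not shorten a
   factorization, because [a <= b]. *)
Lemma gluing_normal_form k1 k2 u v : sum_of m k1 u -> sum_of n k2 v ->
  exists u' v', [/\ insg m u', in_apery n q v', q * u + p * v = q * u' + p * v' &
    k1 + k2 <= ord m u' + ord n v'].
Proof.
have [c] := ubnP v; elim: c => // c IH in k1 k2 u v * => lt_vc k1u k2v.
have Sv : insg n v by apply/insgP; first by []; exists k2.
have [/andP[le_qv Svq]|nSvq] := boolP ((q <= v) && insg n (v - q)); last first.
  exists u, v; split=> //; [by apply/insgP => //; exists k1|exact/andP|].
  by rewrite leq_add // sum_of_leq_ord.
have lt_vqc : v - q < c by lia.
(* The pair (p + u, v - q) represents the same element, with factorizations of lengths b + k1 and
   [ord n (v - q)]. *)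
have [] := IH _ _ _ _ lt_vqc (sum_ofD pE k1u) (sum_of_ord Svq).
move=> u' [v' [Su' Av' e le_k]]; exists u', v'; split=> //; first by nia.
(* k2 <= ord n v = a + ord n (v - q) <= b + ord n (v - q). *)
apply: leq_trans le_k; have := sum_of_leq_ord n_gt0 k2v.
rewrite -{1}(subnKC le_qv) ord_addq //; lia.
Qed.

(** Coprimality makes v and v' congruent modulo q. If they differed, the larger would be the smaller
    plus a positive multiple of q, and q could be subtracted from it inside the semigroup. *)
Lemma gluing_normal_form_uniq u v u' v' :
  in_apery n q v -> in_apery n q v' -> q * u + p * v = q * u' + p * v' ->
  u = u' /\ v = v'.
Proof.
have le_v w t w' t' : in_apery n q t -> in_apery n q t' ->
    q * w + p * t = q * w' + p * t' -> t' <= t.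
  move=> /andP[St _] /andP[_ At'] e; rewrite leqNgt; apply/negP => lt_tt'.
  have : q %| p * (t' - t).
    by apply/dvdnP; exists (w - w'); rewrite mulnBr mulnBl -!(mulnC q); lia.
  rewrite Gauss_dvdr 1?coprime_sym // => /dvdnP[[|c] tE]; first by lia.
  have /negP[] := At'; apply/andP; split; first by lia.
  have -> : t' - q = c * q + t by lia.
  apply: insgD => //; apply/insgP => //.
  by exists (c * ord n q); apply/sum_ofM/sum_of_ord => //; apply: insg_gluing.
move=> Av Av' e; have vE : v = v'.
  apply/eqP; rewrite eqn_leq (le_v _ _ _ _ Av Av' e).
  by rewrite (le_v _ _ _ _ Av' Av (esym e)).
by split=> //; nia.
Qed.

(** Concatenation gives one inequality. For the other, a longest factorization is brought to normal
    form without losing length, and that form is (u, v) by uniqueness. *)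
Lemma ord_glue u v : insg m u -> in_apery n q v ->
  insg mn (q * u + p * v) /\ ord mn (q * u + p * v) = ord m u + ord n v.
Proof.
move=> Su Av; have /andP[Sv _] := Av.
have uv := sum_of_glue (sum_of_ord Su) (sum_of_ord Sv).
have Suv : insg mn (q * u + p * v).
  by apply/insgP; [apply: glue_gt0|exists (ord m u + ord n v)].
split=> //; apply/eqP; rewrite eqn_leq sum_of_leq_ord ?glue_gt0 // andbT.
have /sum_of_glueP[k1 [u1 [k2 [v1 [-> e k1u k2v]]]]] := sum_of_ord Suv.
have [u' [v' [Su' Av' e' le_k]]] := gluing_normal_form k1u k2v.
by move: e; rewrite e' => /(gluing_normal_form_uniq Av Av')[-> ->].
Qed.

Lemma insg_glueP s : insg mn s ->
  exists u v, [/\ insg m u, in_apery n q v & s = q * u + p * v].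
Proof.
case/(insgP glue_gt0) => k /sum_of_glueP[k1 [u1 [k2 [v1 [_ -> k1u k2v]]]]].
by have [u [v [Su Av -> _]]] := gluing_normal_form k1u k2v; exists u, v.
Qed.

(** Each Apery element v contributes the levels of m shifted by [ord n v]. The bound B is left free
    so that k and k + 1 can share one range. *)
Lemma size_level_glue B k : k * \max_(y <- n) y < B ->
  size (level mn k) =
  \sum_(v <- iota 0 B | in_apery n q v && (ord n v <= k))
    size (level m (k - ord n v)).
Proof.
move=> lt_B; rewrite -big_filter.
set V := filter _ _.
have VP v : (v \in V) = in_apery n q v && (ord n v <= k).
  rewrite mem_filter mem_iota /= add0n.
  case: (boolP (in_apery n q v && _)) => //= /andP[/andP[Sv _] le_k].
  apply: leq_ltn_trans lt_B; apply: leq_trans (sum_of_bound (sum_of_ord Sv)) _.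
  by rewrite leq_mul2r le_k orbT.
transitivity (size [seq q * u + p * v | v <- V, u <- level m (k - ord n v)]);
  last first.
  by rewrite size_allpairs_dep sumnE big_map.
apply/perm_size/uniq_perm; first exact: level_uniq.
  apply: allpairs_uniq_dep => [|v _|].
  - exact/filter_uniq/iota_uniq.
  - exact: level_uniq.
  move=> _ _ /allpairsPdep[v [u [+ _ ->]]] /allpairsPdep[v' [u' [+ _ ->]]] /=.
  rewrite !VP => /andP[Av _] /andP[Av' _].
  by move=> /(gluing_normal_form_uniq Av Av')[-> ->].
move=> s; apply/idP/allpairsPdep => [|[v [u []]]].
  rewrite mem_level => /andP[/insg_glueP[u [v [Su Av ->]]]].
  have [_ ->] := ord_glue Su Av => /eqP ordE.
  by exists v, u; rewrite VP mem_level Av Su /=; split=> //; [lia|apply/eqP; lia].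
rewrite VP !mem_level => /andP[Av le_k] /andP[Su /eqP ordE] ->.
by have [-> ->] := ord_glue Su Av; rewrite /=; apply/eqP; lia.
Qed.

Lemma size_level_glue_nondecreasing :
  (forall k, size (level m k) <= size (level m k.+1)) ->
  forall k, size (level mn k) <= size (level mn k.+1).
Proof.
move=> H k; set B := (k.+1 * \max_(y <- n) y).+1.
rewrite (@size_level_glue B) ?ltnS ?leq_mul2r ?leqnSn ?orbT //.
rewrite (@size_level_glue B) // big_mkcond [X in _ <= X]big_mkcond leq_sum // => v _.
(* Terms with [ord n v > k] vanish on the left; the others compare consecutive levels of m. *)
case: (in_apery n q v) => //=; case: (leqP (ord n v) k) => // le_k.
by rewrite (leqW le_k) subSn.
Qed.
End Gluing.

Local Open Scope classical_set_scope.
Local Open Scope ring_scope.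

(** * The Hilbert function of a semigroup ring *)

Section QuotDim.
Variables (K : fieldType) (V : lmodType K) (W U : set V).
Hypotheses (U0 : U 0) (UD : forall x y, U x -> U y -> U (x + y))
  (UZ : forall (a : K) x, U x -> U (a *: x)).

(** Expanding e in f and f in e modulo U gives matrices with A B = 1 of size k, which forces k <=
    l. *)
Lemma is_basis_mod_leq k l (e : 'I_k -> V) (f : 'I_l -> V) :
  is_basis_mod W U e -> is_basis_mod W U f -> (k <= l)%N.
Proof.
move=> [We freeE spanE] [Wf _ spanF].
have [A eA] := choice (fun i => spanF _ (We i)).
have [B fB] := choice (fun i => spanE _ (Wf i)).
apply: (@mulmx1_min _ _ _ (\matrix_(i, j) A i j) (\matrix_(i, j) B i j)).
apply/matrixP => i j; apply/eqP; rewrite eq_sym -subr_eq0; apply/eqP.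
(* Freeness modulo U is applied to row i of 1 - A B, whose combination of the e splits into the
   errors of the two expansions. *)
apply: (freeE (fun j => (1%:M : 'M_k) i j - (_ *m _) i j)).
have -> : \sum_j0 (1%:M i j0 - (\matrix_(i, j) A i j *m \matrix_(i, j) B i j) i j0)
    *: e j0 = (e i - \sum_j A i j *: f j) +
              \sum_j A i j *: (f j - \sum_h B j h *: e h).
  under eq_bigr do rewrite scalerBl; rewrite sumrB.
  rewrite (bigD1 i) //= mxE eqxx scale1r big1 ?addr0; last first.
    by move=> h; rewrite mxE eq_sym => /negPf->; rewrite scale0r.
  under [X in _ = _ + X]eq_bigr do rewrite scalerBr scaler_sumr.
  rewrite sumrB addrA subrK; congr (_ - _); rewrite exchange_big /=.
  apply: eq_bigr => h _; rewrite mxE scaler_suml; apply: eq_bigr => j0 _.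
  by rewrite !mxE scalerA.
apply: UD => //; apply: (big_ind U) => // h _; exact: UZ.
Qed.

Lemma quot_dimE k (e : 'I_k -> V) : is_basis_mod W U e -> quot_dim W U = k.
Proof.
move=> bE; rewrite /quot_dim; case: xgetP => [l _ [f bF]|/(_ k)[]]; last by exists e.
by apply/eqP; rewrite eqn_leq (is_basis_mod_leq bF bE) (is_basis_mod_leq bE bF).
Qed.
End QuotDim.

(** * Inverses of power series *)

Section FpsInverse.
Variable K : fieldType.

(** The first k coefficients of 1 / f, each solved from the equation f g = 1 in its degree. *)
Fixpoint fps_inv_seq (f : fps K) k : seq K :=
  if k is k'.+1 then
    let s := fps_inv_seq f k' in
    rcons s (((k' == 0%N)%:R - \sum_(i < k') f i.+1 * s`_(k' - i.+1)) / f 0%N)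
  else [::].

Lemma fps_inverse (f : fps K) : f 0%N != 0 -> exists g, f * g = 1.
Proof.
move=> f0; pose s := fps_inv_seq f.
have size_s k : size (s k) = k by elim: k => //= k IH; rewrite size_rcons IH.
have nth_s k i : (i < k)%N -> (s k)`_i = (s i.+1)`_i.
  elim: k => // k IH; rewrite ltnS leq_eqVlt => /orP[/eqP-> //|lt_ik].
  by rewrite -IH //= nth_rcons size_s lt_ik.
exists (Fps (fun k => (s k.+1)`_k)); apply: fpsP => k.
rewrite [LHS]big_ord_recl /= subn0 nth_rcons size_s ltnn eqxx -/s.
rewrite mulrCA divff // mulr1 -addrA -[RHS]addr0; congr (_ + _).
apply/eqP; rewrite addrC subr_eq0; apply/eqP; apply: eq_bigr => i _.
rewrite /bump /= add1n -/s; congr (_ * _); symmetry.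
by rewrite nth_s //; have := ltn_ord i; lia.
Qed.
End FpsInverse.

(** * Powers of the maximal ideal of K[[S]] *)

Section HilbertFunction.
Variables (K : fieldType) (d : seq nat).
Hypothesis d_gt0 : all (leq 1) d.
Local Notation A := (psring K d).
Implicit Types f g : A.

Lemma psringP (f : fps K) :
  (f \in @psring_pred K d) <-> forall s, f s != 0 -> insg d s.
Proof.
split=> [/asboolP/in_psringP fS s /fS/(insgE d_gt0)//|fS].
by apply/asboolP/in_psringP => s /fS/(insgE d_gt0).
Qed.

Lemma psval_supp f s : psval f s != 0 -> insg d s.
Proof. by apply/psringP: s; case: f. Qed.

Lemma psringE f g : (forall s, psval f s = psval g s) -> f = g.
Proof. by move=> fg; apply/val_inj/fpsP. Qed.

Fact psring_of_subproof (c : nat -> K) :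
  Fps (fun s => if insg d s then c s else 0) \in @psring_pred K d.
Proof. by apply/psringP => s /=; case: ifP; rewrite ?eqxx. Qed.
Definition psring_of c : A := PSRing (psring_of_subproof c).

Lemma psvalD f g s : psval (f + g) s = psval f s + psval g s.
Proof. by []. Qed.

Lemma psvalB f g s : psval (f - g) s = psval f s - psval g s.
Proof. by []. Qed.

Lemma psvalZ (a : K) f s : psval (a *: f) s = a * psval f s.
Proof. by []. Qed.

Lemma psvalM f g s :
  psval (f * g) s = \sum_(i < s.+1) psval f i * psval g (s - i)%N.
Proof. by []. Qed.

Lemma psval_sum I (r : seq I) (F : I -> A) s :
  psval (\sum_(i <- r) F i) s = \sum_(i <- r) psval (F i) s.
Proof. exact: (big_morph (fun f => psval f s)). Qed.

Definition ord_filt k : set A :=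
  [set f | forall s, psval f s != 0 -> (k <= ord d s)%N].

Lemma ord_filt0 : ord_filt 0 = setT.
Proof. by apply/seteqP; split. Qed.

(** [ord] is superadditive, and a nonzero coefficient of f g at s needs support elements i and s -
    i. *)
Lemma ord_filtM j k f g : ord_filt j f -> ord_filt k g -> ord_filt (j + k) (f * g).
Proof.
move=> fj gk s; apply: contra_neqT; rewrite -ltnNge => lt_s.
rewrite psvalM big1 // => i _; apply/eqP; apply: contraTT lt_s.
rewrite mulf_eq0 negb_or -leqNgt => /andP[fi gi].
have le_is : (i <= s)%N by rewrite -ltnS.
rewrite -(subnKC le_is); apply: leq_trans (leq_ordD d_gt0 _ _).
- by rewrite leq_add ?fj ?gk.
- exact: psval_supp fi.
- exact: psval_supp gi.
Qed.

Lemma ord_filt_ideal k : is_ideal (ord_filt k).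
Proof.
split=> [s|f g fk gk s|a f fk]; first by rewrite eqxx.
  rewrite psvalD; have [->|/fk//] := eqVneq (psval f s) 0.
  by rewrite add0r => /gk.
by rewrite -[k]add0n; apply: ord_filtM => //; rewrite ord_filt0.
Qed.

Lemma ord_eq0 s : insg d s -> (ord d s == 0%N) = (s == 0%N).
Proof.
move=> Ss; apply/eqP/eqP => [ord0|->].
  by have := sum_of_ord Ss; rewrite ord0 => /eqP.
by apply/eqP; rewrite -leqn0; apply/bigmax_leqP => i _; rewrite -ltnS.
Qed.

Lemma ord_filt1P f : ord_filt 1 f <-> psval f 0%N = 0.
Proof.
have S0 : insg d 0 by apply/insgP => //; exists 0%N.
split=> [f1|f0 s fs].
  by apply/eqP; apply: contraT => /f1; rewrite lt0n ord_eq0.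
rewrite lt0n ord_eq0 ?(psval_supp fs) //.
by apply: contra_neq fs => ->.
Qed.

(** The inverse g exists in K[[t]]. For s outside the semigroup, induction kills all f_i g_(s-i)
    with i > 0, leaving f_0 g_s = 0. *)
Lemma psring_inverse f : psval f 0%N != 0 -> exists g, f * g = 1.
Proof.
move=> f0; have [g fg] := fps_inverse f0.
have gS : g \in @psring_pred K d.
  apply/psringP => s; have [c] := ubnP s; elim: c s => // c IH s lt_sc.
  have [->|s_gt0] := posnP s; first by move=> _; apply/insgP => //; exists 0%N.
  apply: contra_neqT => nSs.
  have := congr1 (fun h : fps K => h s) fg => /=; rewrite (negPf (lt0n_neq0 s_gt0)).
  rewrite big_ord_recl /= big1 ?addr0 ?subn0 => [/eqP|i _]; last first.
    apply/eqP; apply: contraNT nSs; rewrite mulf_eq0 negb_or => /andP[fi gi].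
    have le_is : (bump 0 i <= s)%N by rewrite /bump /= add1n.
    rewrite -(subnKC le_is); apply: insgD => //; first exact: psval_supp fi.
    by apply: IH => //; rewrite /bump /= add1n; lia.
  by rewrite mulf_eq0 (negPf f0) => /eqP.
by exists (PSRing gS); apply: val_inj.
Qed.

Lemma nonunits_psring : nonunits A = ord_filt 1.
Proof.
apply/seteqP; split=> f.
  move=> nf; apply/ord_filt1P/eqP; apply: contraT => /psring_inverse[g fg].
  by case: nf; exists g.
move=> /ord_filt1P f0 [g /(congr1 (fun h => psval h 0%N))].
rewrite psvalM big_ord_recl big_ord0 f0 mul0r addr0 => /esym/eqP.
by rewrite oner_eq0.
Qed.

(** The monomial t^s, or 0 when s lies outside the semigroup. *)
Definition tpow s : A := psring_of (fun i => (i == s)%:R).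

Lemma psval_tpow s i : insg d s -> psval (tpow s) i = (i == s)%:R.
Proof. by move=> Ss /=; case: eqP => [->|]; rewrite ?Ss ?if_same. Qed.

Lemma psval_tpowM s f i : insg d s ->
  psval (tpow s * f) i = if (s <= i)%N then psval f (i - s)%N else 0.
Proof.
move=> Ss; rewrite psvalM; case: leqP => [le_si|lt_is].
  have lt_si : (s < i.+1)%N by [].
  rewrite (bigD1 (Ordinal lt_si)) // psval_tpow // eqxx mul1r.
  rewrite big1 => [|j ne_js]; first exact: addr0.
  by rewrite psval_tpow // (negPf (ne_js : j != s :> nat)) mul0r.
rewrite big1 // => j _; rewrite psval_tpow //.
by rewrite ltn_eqF ?mul0r // (leq_ltn_trans _ lt_is) // -ltnS.
Qed.

Lemma ord_filt_tpow s : insg d s -> ord_filt (ord d s) (tpow s).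
Proof.
by move=> Ss i; rewrite psval_tpow //; case: (i =P s) => [->|]; rewrite ?eqxx.
Qed.

(* Each monomial of f of order > k is divisible by some t^x with x in d and
   quotient of order >= k; collecting the quotients by x writes f as a sum of
   [size d] products. *)
Lemma ord_filtS_decomp k f : ord_filt k.+1 f ->
  exists g : 'I_(size d) -> A,
    (forall i, ord_filt k (g i)) /\ f = \sum_(i < size d) tpow (nth 0%N d i) * g i.
Proof.
move=> fk.
pose P s x := [&& (x <= s)%N, insg d (s - x) & (k <= ord d (s - x))%N].
(* [find] assigns each s to a single generator, so no coefficient of f is counted twice. *)
pose g (i : 'I_(size d)) : A := psring_of (fun t =>
  if find (P (t + nth 0 d i)%N) d == i then psval f (t + nth 0 d i)%N else 0).
have Pfind s : (find (P s) d < size d)%N -> P s (nth 0%N d (find (P s) d)).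
  by rewrite -has_find; apply: nth_find.
have Sd i : (i < size d)%N -> insg d (nth 0%N d i).
  by move=> lt_id; apply/insgP => //; exists 1%N; apply/sum_of1/mem_nth.
exists g; split=> [i t|] /=.
  case: insg; last by rewrite eqxx.
  case: (find _ _ =P i :> nat) => [fi _|]; last by rewrite eqxx.
  have := Pfind (t + nth 0 d i)%N; rewrite fi /P addnK ltn_ord.
  by move=> /(_ isT)/and3P[].
apply: psringE => s; rewrite psval_sum.
have gE (i : 'I_(size d)) : psval (tpow (nth 0%N d i) * g i) s =
    if find (P s) d == i then psval f s else 0.
  rewrite psval_tpowM ?Sd //=; case: leqP => [le_is|lt_si].
    rewrite subnK //; case: eqP => [fi|]; last by rewrite if_same.
    by have := Pfind s; rewrite fi ltn_ord => /(_ isT)/and3P[_ -> _].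
  case: eqP => // fi; have := Pfind s; rewrite fi ltn_ord => /(_ isT)/and3P[].
  by rewrite leqNgt lt_si.
under eq_bigr do rewrite gE.
have [->|fs] := eqVneq (psval f s) 0.
  by rewrite big1 // => i _; rewrite if_same.
(* A longest factorization of s has more than k terms; dropping one leaves an element of order at
   least k. *)
have hasP : (find (P s) d < size d)%N.
  rewrite -has_find; have := sum_of_ord (psval_supp fs); have := fk _ fs.
  case: (ord d s) => // l le_kl /sum_ofSP[x [t [xd lt ->]]].
  apply/hasP; exists x => //; rewrite /P leq_addr addKn /=; apply/andP; split.
    by apply/insgP => //; exists l.
  exact: leq_trans (le_kl : (k <= l)%N) (sum_of_leq_ord d_gt0 lt).
rewrite (bigD1 (Ordinal hasP)) //= eqxx big1 ?addr0 // => i.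
by rewrite eq_sym -val_eqE /= => /negPf->.
Qed.

Lemma pow_nonunits k : pow_ideal (nonunits A) k = ord_filt k.
Proof.
elim: k => [|k IH]; first by rewrite ord_filt0.
rewrite /pow_ideal iterS -/(pow_ideal _ k) IH nonunits_psring.
apply/seteqP; split=> f.
  apply; split; first exact: ord_filt_ideal.
  by move=> _ [g g1 [h hk <-]]; rewrite -add1n; apply: ord_filtM.
move=> /ord_filtS_decomp[g [gk ->]] J [[J0 JD _] JP].
apply: (big_ind J) => // i _; apply: JP; exists (tpow (nth 0%N d i)).
  have xd : nth 0%N d i \in d by exact: mem_nth.
  apply/ord_filt1P; rewrite psval_tpow; last first.
    by apply/insgP => //; exists 1%N; apply: sum_of1.
  by rewrite eq_sym eqn0Ngt (allP d_gt0 _ xd).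
by exists (g i).
Qed.

(** Modulo order above k, only the finitely many coefficients at [level d k] survive. *)
Lemma ord_filt_basis k :
  is_basis_mod (ord_filt k) (ord_filt k.+1)
    (fun i : 'I_(size (level d k)) => tpow (nth 0%N (level d k) i)).
Proof.
set l := level d k.
have lP i : (i < size l)%N -> insg d (nth 0%N l i) /\ ord d (nth 0%N l i) = k.
  by move=> /(mem_nth 0%N); rewrite mem_level => /andP[Si /eqP].
have sumE (c : 'I_(size l) -> K) s : psval (\sum_i c i *: tpow (nth 0%N l i)) s =
    \sum_i c i * (s == (nth 0%N l i))%:R.
  rewrite psval_sum; apply: eq_bigr => i _; rewrite psvalZ psval_tpow //.
  by have [] := lP _ (ltn_ord i).
have sum_nth (c : 'I_(size l) -> K) (i : 'I_(size l)) :
    \sum_j c j * ((nth 0%N l i) == (nth 0%N l j))%:R = c i.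
  rewrite (bigD1 i) //= eqxx mulr1 big1 ?addr0 // => j.
  rewrite -val_eqE /= => ne_ji; rewrite nth_uniq ?level_uniq // eq_sym.
  by rewrite (negPf ne_ji) mulr0.
split=> [i|c ck i|w wk].
- by have [Si ordi] := lP _ (ltn_ord i); rewrite -{1}ordi; apply: ord_filt_tpow.
- apply/eqP; apply: contraT => ci; have := ck (nth 0%N l i).
  rewrite sumE sum_nth => /(_ ci).
  by have [_ ->] := lP _ (ltn_ord i); rewrite ltnn.
exists (fun i => psval w (nth 0%N l i)) => s; rewrite psvalB sumE.
have [/(nthP 0%N)[i lt_il <-]|sl] := boolP (s \in l).
  by rewrite (sum_nth _ (Ordinal lt_il)) subrr eqxx.
rewrite big1 ?subr0 => [ws|i _]; last first.
  by case: eqP sl => [->|_]; rewrite ?mulr0 // mem_nth.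
rewrite ltn_neqAle wk // andbT eq_sym; apply: contra sl => /eqP ordk.
by rewrite mem_level (psval_supp ws) ordk eqxx.
Qed.

Lemma hilbert_function_psring k : hilbert_function A k = size (level d k).
Proof.
rewrite /hilbert_function !pow_nonunits; have [I0 ID IM] := ord_filt_ideal k.+1.
apply: quot_dimE (ord_filt_basis k) => // a f fk s; rewrite psvalZ mulf_eq0 negb_or.
by case/andP=> _ /fk.
Qed.
End HilbertFunction.

(** * Cohen-Macaulay tangent cones *)

Section RingKernels.
Variable A : comPzRingType.

(** The morphism laws are explicit because the maps used later are defined through representatives
    of a quotient and are not bundled as ring morphisms. *)
Lemma prime_ker (D : idomainType) (f : A -> D) :
  f 1 = 1 -> {morph f : x y / x + y} -> {morph f : x y / x * y} ->
  is_prime_ideal [set x | f x = 0].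
Proof.
move=> f1 fD fM; split=> [||x y /=].
- have f0 : f 0 = 0 by apply: (@addrI _ (f 0)); rewrite -fD !addr0.
  split=> //= [x y fx fy|a x fx]; first by rewrite fD fx fy addr0.
  by rewrite fM fx mulr0.
- by move=> /= /eqP; rewrite f1 oner_eq0.
by rewrite fM => /eqP; rewrite mulf_eq0 => /orP[/eqP|/eqP]; [left|right].
Qed.

Lemma maximal_ker (K : fieldType) (f : A -> K) :
  f 1 = 1 -> {morph f : x y / x + y} -> {morph f : x y / x * y} ->
  (forall c, exists x, f x = c) -> is_maximal_ideal [set x | f x = 0].
Proof.
move=> f1 fD fM f_surj; have [fI nf1 _] := prime_ker f1 fD fM.
split=> // J IJ J1 sfJ.
apply/seteqP; split=> // x Jx /=; apply/eqP; apply: contraT => fx; case: J1.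
(* 1 = (1 - y x) + y x, with 1 - y x in the kernel. *)
have [y fy] := f_surj (f x)^-1; have [_ JD JM] := IJ.
rewrite -[1](subrK (y * x)); apply: JD; last exact: JM.
apply: sfJ => /=; rewrite fD -mulNr fM.
have fN z : f (- z) = - f z.
  by have [f0 _ _] := fI; apply: (@addrI _ (f z)); rewrite -fD !subrr.
by rewrite fN fy f1 mulNr mulVf // subrr.
Qed.
End RingKernels.

(** * Primes of a localization, and depth *)

Section LocalizedIdeal.
Variables (A : comPzRingType) (M : set A) (MM : is_prime_ideal M).
Local Notation L := (localization MM).
Local Notation "x /: s" := (loc_frac MM x s) (at level 40).
Local Notation one := (loc_one MM).

Lemma locD x s y t : (x /: s) + (y /: t) =
  (x * sval t + y * sval s) /: (loc_mulden MM s t).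
Proof. exact: loc_fracD. Qed.

Lemma locM x s y t : (x /: s) * (y /: t) = (x * y) /: (loc_mulden MM s t).
Proof. exact: loc_fracM. Qed.

Lemma loc1E : 1 = 1 /: one :> L. Proof. by []. Qed.
Lemma loc0E : 0 = 0 /: one :> L. Proof. by []. Qed.

(** The extension of P, read off a chosen representative; [loc_idealE] makes the choice harmless for
    a prime P inside M. *)
Definition loc_ideal (P : set A) : set L := [set u | P (repr u).1].

Lemma loc_idealE (P : set A) x s :
  is_prime_ideal P -> P `<=` M -> loc_ideal P (x /: s) <-> P x.
Proof.
move=> [[P0 PD PMl] P1 PM] sPM; rewrite /loc_ideal /=.
(* Numerators of equal fractions agree up to factors outside M, hence outside P, which primality
   cancels. *)
have /loc_fracE[w [Mw e]] := loc_frac_repr (x /: s).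
move: e; set a := (repr _).1; set t := (repr _).2 => /eqP.
rewrite mulrBr subr_eq0 => /eqP e.
have notP z : ~ M z -> ~ P z by move=> Mz /sPM.
split=> [Pa|Px].
  have : P (w * (x * sval t)) by rewrite -e; apply: (PMl); rewrite mulrC; apply: PMl.
  case/PM => [/notP//|/PM[//|/notP]]; case; exact: loc_denP.
have : P (w * (a * sval s)) by rewrite e; apply: (PMl); rewrite mulrC; apply: PMl.
by case/PM => [/notP//|/PM[//|/notP]]; case; exact: loc_denP.
Qed.

Lemma loc_ideal_prime (P : set A) :
  is_prime_ideal P -> P `<=` M -> is_prime_ideal (loc_ideal P).
Proof.
move=> PP sPM; have [[P0 PD PMl] P1 PM] := PP.
have E x s := loc_idealE x s PP sPM.
split=> [||u v].
- split=> [|u v|u v]; first by rewrite loc0E E.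
    rewrite -(loc_frac_repr u) -(loc_frac_repr v) locD !E => Pu Pv.
    by apply: PD; rewrite mulrC; apply: PMl.
  by rewrite -(loc_frac_repr u) -(loc_frac_repr v) locM !E; apply: PMl.
- by rewrite loc1E E.
by rewrite -(loc_frac_repr u) -(loc_frac_repr v) locM !E; apply: PM.
Qed.

Lemma nonunits_loc u : nonunits L u -> M (repr u).1.
Proof.
move=> nu; apply: contrapT => Mu; case: nu.
exists (sval (repr u).2 /: exist _ (repr u).1 (asboolT Mu)).
rewrite -{1}(loc_frac_repr u) locM loc1E; apply: eq_loc_frac => /=.
by rewrite mulr1 mul1r mulrC.
Qed.

(* A prime strictly below M forces dimension, hence depth, at least 1, so that
   M cannot be the annihilator of an element. *)
Lemma cm_not_annihilator (P : set A) :
  is_prime_ideal P -> P `<` M -> is_maximal_ideal M -> cohen_macaulay A ->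
  ~ exists y, forall x, x * y = 0 <-> M x.
Proof.
move=> PP [sPM nsMP] maxM [_ /(_ M MM maxM)[_ _ [k [[_ dim_k]]]]].
move=> [[s [sk s_nu s_reg]] _].
move=> [y yM].
(* The extensions of P and M form a chain of length 1, so the dimension k, which is also the depth,
   is positive. *)
have k_gt0 : (0 < k)%N.
  apply: dim_k; exists (fun i => if i == 0%N then loc_ideal P else loc_ideal M).
  split=> [[|i] _|[|//] _] /=; [exact: loc_ideal_prime..|].
  split=> [u|sMP]; first by rewrite -(loc_frac_repr u) !loc_idealE //; apply: sPM.
  apply: nsMP => x Mx; rewrite -(loc_idealE x one) //; apply: sMP.
  by rewrite loc_idealE.
(* The first element u of the regular sequence has numerator in M, so it kills y / 1. Regularity
   gives y / 1 = 0, that is w y = 0 for some w outside M. *)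
case: s sk s_nu s_reg => [sk|u s sk s_nu [/(_ 0%N isT (y /: one)) + _]].
  by move: k_gt0; rewrite -sk.
rewrite /= => u_reg.
have uy0 : u * (y /: one) = 0.
  have /nonunits_loc/yM uy : nonunits L u by apply: s_nu; rewrite /= mem_head.
  rewrite -(loc_frac_repr u) locM uy loc0E; apply: eq_loc_frac.
  by rewrite !mul0r.
have : gen_ideal [set` [::]] (u * (y /: one)).
  by rewrite uy0; have [] := gen_ideal_ideal [set` [::] : seq L].
move=> /u_reg /(_ [set 0]) y0; have : y /: one = 0.
  by apply: y0; split=> //; split=> // [a b -> ->|a b ->]; rewrite ?addr0 ?mulr0.
rewrite loc0E => /loc_fracE[w [Mw]] /=; rewrite mulr1 mul0r subr0.
by move=> /yM.
Qed.
End LocalizedIdeal.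

(** * Monomials in the tangent cone *)

Section TangentConeMonomials.
Variables (K : fieldType) (d : seq nat).
Hypothesis d_gt0 : all (leq 1) d.
Local Notation r := (size d).
Local Notation weight := (@weight d).
Local Notation T := (@tangent_cone_ideal K d).
Implicit Types (e m : 'X_{1..r}) (f : {mpoly K[r]}).

Lemma mdeg_leq_ord e : (mdeg e <= ord d (weight e))%N.
Proof. exact/sum_of_leq_ord/sum_of_weight. Qed.

Lemma insg_weight e : insg d (weight e).
Proof. by apply/insgP => //; exists (mdeg e); apply: sum_of_weight. Qed.

(** The range does not depend on f, which makes linearity immediate. *)
Definition mcoeff_sum N (P : pred 'X_{1..r}) f :=
  \sum_(e : 'X_{1..r < N} | P e) f@_e.

Lemma mcoeff_sumE N (P : pred 'X_{1..r}) f : (forall e, P e -> (mdeg e < N)%N) ->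
  mcoeff_sum N P f = \sum_(m <- msupp f | P m) f@_m.
Proof.
move=> PN; rewrite /mcoeff_sum [f in LHS]mpolyE [RHS]big_mkcond /=.
under eq_bigr do rewrite raddf_sum.
rewrite exchange_big /=; apply: eq_bigr => m _.
under eq_bigr do rewrite mcoeffZ mcoeffX.
case: ifPn => [Pm|nPm].
  rewrite (bigD1 (BMultinom (PN _ Pm))) //= eqxx mulr1 big1 ?addr0 // => e /andP[_].
  by rewrite -val_eqE eq_sym /= => /negPf->; rewrite mulr0.
by rewrite big1 // => e Pe; case: eqP nPm => [->|]; rewrite ?Pe ?mulr0.
Qed.

Lemma mmap1_tpow e :
  mmap1 (fun i : 'I_r => 'X^(nth 0%N d i)) e = 'X^(weight e) :> {poly K}.
Proof.
rewrite /mmap1 /weight; elim/big_rec2: _ => [|i w p _ ->]; first by rewrite expr0.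
by rewrite exprD -exprM mulnC.
Qed.

Lemma curve_ideal_weight f w :
  curve_ideal f -> \sum_(m <- msupp f | weight m == w) f@_m = 0.
Proof.
move=> /(congr1 (fun p : {poly K} => p`_w)); rewrite coef0 => e0; apply: etrans e0.
rewrite /mmap coef_sum [LHS]big_mkcond /=; apply: eq_bigr => m _.
by rewrite coefCM mmap1_tpow coefXn eq_sym; case: eqP; rewrite ?mulr1 ?mulr0.
Qed.

Lemma curve_ideal_binomial e m :
  weight e = weight m -> curve_ideal ('X_[e] - 'X_[m] : {mpoly K[r]}).
Proof. by move=> em; rewrite /curve_ideal /= mmapB !mmapX !mmap1_tpow em subrr. Qed.

Lemma mcoeff_pihomog k f e :
  (pihomog mdeg k f)@_e = if mdeg e == k then f@_e else 0.
Proof.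
rewrite pihomogE raddf_sum big_mkcond [f in RHS]mpolyE raddf_sum /=.
case: eqP => ek; [apply: eq_bigr => m _|apply: big1 => m _];
  rewrite mcoeffZ mcoeffX; case: (m =P e) => [->|_]; rewrite ?mulr0 ?if_same //.
  by rewrite ek eqxx.
by case: eqP.
Qed.

Lemma min_deg_leq f e : e \in msupp f -> (min_deg f <= mdeg e)%N.
Proof.
rewrite /min_deg; elim: (msupp f) => // m s IH; rewrite inE big_cons geq_min.
by case/orP=> [/eqP->|/IH->]; rewrite ?leqnn ?orbT.
Qed.

Lemma init_form_binomial e m :
  (mdeg e < mdeg m)%N -> init_form ('X_[e] - 'X_[m] : {mpoly K[r]}) = 'X_[e].
Proof.
move=> lt_em; set f := _ - _.
have ne_em : e != m by apply: contraTneq lt_em => ->; rewrite ltnn.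
have fE k : f@_k = (e == k)%:R - (m == k)%:R by rewrite mcoeffB !mcoeffX.
have ef : e \in msupp f.
  by rewrite mcoeff_msupp fE eqxx (eq_sym m) (negPf ne_em) subr0 oner_eq0.
have minE : min_deg f = mdeg e.
  apply/eqP; rewrite eqn_leq min_deg_leq //= /min_deg big_seq.
  apply: (big_ind (fun k => mdeg e <= k)%N) => [|j k ej ek|k].
  - exact/ltnW/msize_mdeg_lt.
  - by rewrite leq_min ej.
  rewrite mcoeff_msupp fE; case: (e =P k) => [-> //|_].
  by case: (m =P k) => [<-|]; rewrite ?subrr ?eqxx // ltnW.
apply/mpolyP => k; rewrite mcoeff_pihomog minE fE mcoeffX.
case: (e =P k) => [<-|_].
  by rewrite eqxx (eq_sym m) (negPf ne_em) subr0.
case: (m =P k) => [<-|]; last by rewrite subrr if_same.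
by rewrite gtn_eqF.
Qed.

(** A longer factorization m of the same weight gives a binomial of the curve ideal whose initial
    form is the monomial of e. *)
Lemma tangent_cone_monomial e :
  (mdeg e < ord d (weight e))%N -> T 'X_[e].
Proof.
move=> lt_e; have [m [mE wm]] := sum_of_multinom (sum_of_ord (insg_weight e)).
have lt_em : (mdeg e < mdeg m)%N by rewrite mE.
move=> J [_ sJ]; apply: sJ; exists ('X_[e] - 'X_[m]).
  split; first exact/curve_ideal_binomial.
  move=> /= /(congr1 (mcoeff e)); rewrite mcoeffB !mcoeffX eqxx mcoeff0.
  case: (m =P e) lt_em => [->|_]; rewrite ?ltnn // subr0 => _ /eqP.
  by rewrite oner_eq0.
exact: init_form_binomial.
Qed.

Definition maximal_fact w e := (weight e == w) && (mdeg e == ord d w).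

Lemma maximal_factD w e m : maximal_fact w (e + m)%MM =
  [&& weight e <= w, mdeg e + ord d (w - weight e) == ord d w
    & maximal_fact (w - weight e) m]%N.
Proof.
rewrite /maximal_fact weightD mdegD.
have := mdeg_leq_ord m; have := leq_ordD d_gt0 (insg_weight e) (insg_weight m).
have := mdeg_leq_ord e.
case: (leqP (weight e) w) => [le_w|]; last by case: eqP => //; lia.
have -> : (weight e + weight m == w)%N = (weight m == w - weight e)%N :> bool by lia.
case: (weight m =P _) => [wm|]; last by rewrite andbF.
have wE : w = (weight e + weight m)%N by lia.
rewrite -wm wE; lia.
Qed.

(* The coefficient at t^w of the image of f in the associated graded ring,
   whose elements t^s form a basis with t^s t^u = t^(s+u) or 0 according to
   whether ord (s + u) = ord s + ord u. *)
Definition gr_coef w f := mcoeff_sum w.+1 (maximal_fact w) f.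

Lemma maximal_fact_mdeg w e : maximal_fact w e -> (mdeg e < w.+1)%N.
Proof.
by case/andP=> /eqP <- _; rewrite ltnS (sum_of_leq d_gt0 (sum_of_weight e)).
Qed.

Lemma gr_coefE w f : gr_coef w f = \sum_(m <- msupp f | maximal_fact w m) f@_m.
Proof. exact/mcoeff_sumE/maximal_fact_mdeg. Qed.

Lemma gr_coefX w e : gr_coef w 'X_[e] = (maximal_fact w e)%:R.
Proof. by rewrite gr_coefE msuppX big_mkcond big_seq1 mcoeffX eqxx; case: ifP. Qed.

Lemma gr_coefD w f g : gr_coef w (f + g) = gr_coef w f + gr_coef w g.
Proof. by rewrite -big_split; apply: eq_bigr => e _; rewrite mcoeffD. Qed.

Lemma gr_coef_sum w I (s : seq I) (F : I -> {mpoly K[r]}) :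
  gr_coef w (\sum_(i <- s) F i) = \sum_(i <- s) gr_coef w (F i).
Proof.
apply: (big_morph (gr_coef w)); first exact: gr_coefD.
by rewrite /gr_coef /mcoeff_sum big1 // => e _; rewrite mcoeff0.
Qed.

Lemma gr_coefZ w (c : K) f : gr_coef w (c *: f) = c * gr_coef w f.
Proof. by rewrite mulr_sumr; apply: eq_bigr => e _; rewrite mcoeffZ. Qed.

(** The right side is linear in the [gr_coef] of g, so the polynomials on which all [gr_coef] vanish
    form an ideal. *)
Lemma gr_coefM w f g : gr_coef w (f * g) = \sum_(e <- msupp f)
  if (weight e <= w)%N && (mdeg e + ord d (w - weight e) == ord d w)%N
  then f@_e * gr_coef (w - weight e) g else 0.
Proof.
rewrite mpolyME gr_coef_sum big_allpairs; apply: eq_bigr => e _.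
under eq_bigr do rewrite gr_coefZ gr_coefX maximal_factD andbA.
case: (_ && _) => /=; last by rewrite big1 // => m _; rewrite mulr0.
rewrite gr_coefE [in RHS]big_mkcond mulr_sumr; apply: eq_bigr => m _ /=.
by rewrite -mulrA; case: maximal_fact; rewrite ?mulr1 ?mulr0.
Qed.

(** If [ord d w] is not the initial degree, no longest factorization of w occurs in the initial
    form. Otherwise all monomials of f of weight w have degree exactly [ord d w], and their
    coefficients sum to 0. *)
Lemma gr_coef_init_form w f : curve_ideal f -> gr_coef w (init_form f) = 0.
Proof.
move=> Cf; rewrite /gr_coef /mcoeff_sum.
under eq_bigr do rewrite mcoeff_pihomog.
have [ordw|ordw] := eqVneq (ord d w) (min_deg f); last first.
  by rewrite big1 // => e /andP[_ /eqP->]; rewrite (negPf ordw).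
have wN e : weight e == w -> (mdeg e < w.+1)%N.
  by move=> /eqP <-; rewrite ltnS (sum_of_leq d_gt0 (sum_of_weight e)).
have := curve_ideal_weight w Cf; rewrite -(mcoeff_sumE _ wN) => e0; apply: etrans e0.
rewrite /mcoeff_sum big_mkcond [RHS]big_mkcond; apply: eq_bigr => e _.
rewrite /maximal_fact ordw.
case: (_ =P w) => //= we; case: eqP => // ne; apply/esym/memN_msupp_eq0.
apply/negP => /min_deg_leq le_e; have := mdeg_leq_ord e.
by rewrite we ordw; lia.
Qed.

Lemma gr_coef_tangent_cone w f : T f -> gr_coef w f = 0.
Proof.
move=> Tf; move: w; apply: (Tf [set f | forall w, gr_coef w f = 0]);
  split; last first.
  by move=> _ [g [Cg _] <-] w; apply: gr_coef_init_form.
split=> [w|g h g0 h0 w|a g g0 w].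
- by rewrite /gr_coef /mcoeff_sum big1 // => e _; rewrite mcoeff0.
- by rewrite gr_coefD g0 h0 addr0.
by rewrite gr_coefM big1 // => e _; rewrite g0 mulr0 if_same.
Qed.

Variable i0 : 'I_r.
Hypothesis min_i0 : forall i, i != i0 -> (nth 0%N d i0 < nth 0%N d i)%N.
Local Notation x0 := (nth 0%N d i0).

Lemma mdeg_weight_min e : (mdeg e * x0 <= weight e)%N.
Proof.
rewrite mdegE big_distrl; apply: leq_sum => i _; rewrite leq_mul2l.
by have [->|/min_i0/ltnW->] := eqVneq i i0; rewrite ?leqnn orbT.
Qed.

Lemma ord_min k : ord d (k * x0) = k.
Proof.
have x0_gt0 : (0 < x0)%N by apply/(allP d_gt0)/mem_nth.
have Sk : sum_of d k (k * x0).
  by rewrite -{1}[k]muln1; apply/sum_ofM/sum_of1/mem_nth.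
apply/eqP; rewrite eqn_leq sum_of_leq_ord // andbT.
have : insg d (k * x0) by apply/insgP => //; exists k.
move=> /sum_of_ord/sum_of_multinom[e [<- we]].
by rewrite -(leq_pmul2r x0_gt0) -we mdeg_weight_min.
Qed.

(** Each of the k summands is at least x0, strictly so for any other generator; a total of k x0
    leaves only x0. *)
Lemma maximal_fact_min k e : maximal_fact (k * x0) e = (e == U_(i0) *+ k)%MM.
Proof.
have wU j : weight (U_(i0) *+ j)%MM = (j * x0)%N.
  rewrite /weight (bigD1 i0) //= mulmnE mnm1E eqxx mul1n big1 ?addn0 // => i ne_i.
  by rewrite mulmnE mnm1E (eq_sym i0) (negPf ne_i).
apply/andP/eqP => [[/eqP we]|->]; last first.
  by rewrite wU ord_min mdegMn mdeg1 mul1n.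
rewrite ord_min => /eqP ek.
have e0 i : i != i0 -> e i = 0%N.
  move=> ne_i; apply/eqP; apply: contraT; rewrite -lt0n => ei.
  suff : (mdeg e * x0 < weight e)%N by rewrite we ek ltnn.
  rewrite mdegE big_distrl /weight (bigD1 i) //= [X in (_ < X)%N](bigD1 i) //=.
  rewrite -addSn leq_add //; first by rewrite ltn_pmul2l ?min_i0.
  apply: leq_sum => j _; rewrite leq_mul2l.
  by have [->|/min_i0/ltnW->] := eqVneq j i0; rewrite ?leqnn orbT.
apply/mnmP => i; rewrite mulmnE mnm1E; case: eqP => [<-|/eqP ne_i]; last first.
  by rewrite e0 // eq_sym.
by rewrite mul1n -ek mdegE (bigD1 i0) //= big1 ?addn0.
Qed.

(** Restriction to the coordinate axis of the least generator. *)
Definition min_eval f : {poly K} :=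
  mmap (@polyC K) (fun i => if i == i0 then 'X else 0) f.

Lemma coef_min_eval f k : (min_eval f)`_k = f@_(U_(i0) *+ k).
Proof.
rewrite /min_eval /mmap coef_sum [f in RHS]mpolyE raddf_sum.
apply: eq_bigr => e _ /=.
rewrite coefCM mcoeffZ mcoeffX; congr (_ * _).
rewrite /mmap1 (bigD1 i0) //= eqxx.
have [eE|/eqP ne_e] := eqVneq e (U_(i0) *+ e i0)%MM.
  rewrite big1 ?mulr1 => [|i ne_i]; last first.
    by rewrite eE mulmnE mnm1E (eq_sym i0) (negPf ne_i) expr0.
  rewrite coefXn eE mulmnE mnm1E eqxx mul1n; congr (_%:R); congr nat_of_bool.
  apply/eqP/eqP => [->//|/mnmP/(_ i0)].
  by rewrite !mulmnE mnm1E eqxx !mul1n.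
have [i ne_i ei] : exists2 i, i != i0 & e i != 0%N.
  apply: contrapT => nex; apply: ne_e; apply/mnmP => i; rewrite mulmnE mnm1E.
  case: eqP => [<-|/eqP ne_i]; first by rewrite mul1n.
  by apply/eqP; apply: contraT => ei; case: nex; exists i => //; rewrite eq_sym.
rewrite (bigD1 i) //= (negPf ne_i) expr0n (negPf ei) mul0r mulr0 coef0.
case: eqP => // eE; move: ei; rewrite eE mulmnE mnm1E (eq_sym i0) (negPf ne_i).
by rewrite mul0n eqxx.
Qed.

(** Since k x0 has only one longest factorization, the k-th coefficient of [min_eval f] is
    [gr_coef (k * x0) f]. *)
Lemma min_eval_tangent_cone f : T f -> min_eval f = 0.
Proof.
move=> Tf; apply/polyP => k; rewrite coef_min_eval coef0.
rewrite -(gr_coef_tangent_cone (k * x0) Tf) gr_coefE.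
rewrite [f in LHS]mpolyE raddf_sum /= [RHS]big_mkcond; apply: eq_bigr => e _.
rewrite mcoeffZ mcoeffX maximal_fact_min.
by case: eqP; rewrite ?mulr1 ?mulr0.
Qed.

(** * The tangent cone ring and two of its primes *)

Local Notation A := (tangent_cone_ring K d).
Local Notation T_ideal :=
  (gen_ideal_ideal [set init_form f | f in @curve_ideal K d `\ 0]).
Definition to_tc f : A := to_rq T_ideal f.

Lemma to_tcE f g : to_tc f = to_tc g <-> T (f - g).
Proof. exact: to_rqE. Qed.

Lemma to_tcD f g : to_tc (f + g) = to_tc f + to_tc g.
Proof. exact/esym/to_rqD. Qed.

Lemma to_tcM f g : to_tc (f * g) = to_tc f * to_tc g.
Proof. exact/esym/to_rqM. Qed.

Lemma to_tc_surj u : exists f, u = to_tc f.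
Proof. by exists (repr u); rewrite /to_tc rq_reprK. Qed.

Definition min_eval_tc (u : A) : {poly K} := min_eval (repr u).

Lemma min_evalB : {morph min_eval : f g / f - g}.
Proof. exact: mmapB. Qed.

Lemma min_evalD : {morph min_eval : f g / f + g}.
Proof. exact: mmapD. Qed.

Lemma min_evalM : {morph min_eval : f g / f * g}.
Proof. exact: rmorphM. Qed.

Lemma min_eval_tcE f : min_eval_tc (to_tc f) = min_eval f.
Proof.
apply/eqP; rewrite -subr_eq0 -min_evalB; apply/eqP/min_eval_tangent_cone.
exact: rq_repr.
Qed.

Lemma min_eval_tcD : {morph min_eval_tc : u v / u + v}.
Proof.
move=> u v; have [f ->] := to_tc_surj u; have [g ->] := to_tc_surj v.
by rewrite -to_tcD !min_eval_tcE min_evalD.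
Qed.

Lemma min_eval_tcM : {morph min_eval_tc : u v / u * v}.
Proof.
move=> u v; have [f ->] := to_tc_surj u; have [g ->] := to_tc_surj v.
by rewrite -to_tcM !min_eval_tcE min_evalM.
Qed.

Lemma min_eval_tc1 : min_eval_tc 1 = 1.
Proof. by rewrite (min_eval_tcE 1); exact: rmorph1. Qed.

(** The prime of the axis; it lies strictly below the maximal ideal [tc_max] of the origin, so the
    dimension there is positive. *)
Definition tc_nil : set A := [set u | min_eval_tc u = 0].
Definition tc_max : set A := [set u | (min_eval_tc u).[0] = 0].

Lemma tc_maxE f : tc_max (to_tc f) <-> f@_0%MM = 0.
Proof.
by rewrite /tc_max /= min_eval_tcE horner_coef0 coef_min_eval mulm0n.
Qed.

Lemma tc_nil_prime : is_prime_ideal tc_nil.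
Proof. exact: prime_ker min_eval_tc1 min_eval_tcD min_eval_tcM. Qed.

Lemma tc_max_ker : [/\ (min_eval_tc 1).[0] = 1,
  {morph (fun u => (min_eval_tc u).[0]) : u v / u + v} &
  {morph (fun u => (min_eval_tc u).[0]) : u v / u * v}].
Proof.
split=> [|u v|u v]; first by rewrite min_eval_tc1 hornerC.
  by rewrite min_eval_tcD hornerD.
by rewrite min_eval_tcM hornerM.
Qed.

Lemma tc_max_prime : is_prime_ideal tc_max.
Proof. by have [f1 fD fM] := tc_max_ker; apply: prime_ker f1 fD fM. Qed.

Lemma tc_max_maximal : is_maximal_ideal tc_max.
Proof.
have [f1 fD fM] := tc_max_ker; apply: maximal_ker f1 fD fM _ => c.
exists (to_tc c%:MP); rewrite min_eval_tcE horner_coef0 coef_min_eval mulm0n.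
by rewrite mcoeffC eqxx mulr1.
Qed.

Lemma tc_nil_proper : tc_nil `<` tc_max.
Proof.
split=> [u /= u0|/(_ (to_tc 'X_i0))]; first by rewrite /tc_max /= u0 horner0.
rewrite tc_maxE mcoeffX mnm1_eq0 => /(_ erefl); rewrite /tc_nil /= min_eval_tcE.
move=> /(congr1 (fun p : {poly K} => p`_1)).
rewrite coef_min_eval coef0 mcoeffX mulm1n eqxx => /eqP.
by rewrite oner_eq0.
Qed.

(** A longer factorization of the part c would lengthen the whole. *)
Lemma mdeg_eq_ord_sub c e :
  mdeg (e + c)%MM = ord d (weight (e + c)%MM) -> mdeg c = ord d (weight c).
Proof.
rewrite mdegD weightD; have := mdeg_leq_ord e; have := mdeg_leq_ord c.
have := leq_ordD d_gt0 (insg_weight e) (insg_weight c); lia.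
Qed.

(* A monomial nonzero in the tangent cone has e_i < x0 for i <> i0, since
   x0 copies of d_i can be traded for d_i > x0 copies of x0. *)
Lemma maximal_fact_bound e i :
  mdeg e = ord d (weight e) -> i != i0 -> (e i < x0)%N.
Proof.
move=> eE ne_i; rewrite ltnNge; apply/negP => le_x0.
pose c := (U_(i) *+ x0)%MM.
have ce : ((e - c) + c)%MM = e.
  apply: submK; apply/mnm_lepP => j; rewrite mulmnE mnm1E.
  by case: eqP => [<-|//]; rewrite mul1n.
have := mdeg_eq_ord_sub (e := (e - c)%MM) (c := c); rewrite ce => /(_ eE).
have -> : weight c = (nth 0%N d i * x0)%N.
  rewrite /weight (bigD1 i) //= mulmnE mnm1E eqxx mul1n.
  rewrite big1 ?addn0 1?mulnC // => j ne_j.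
  by rewrite mulmnE mnm1E eq_sym (negPf ne_j).
by rewrite ord_min mdegMn mdeg1 mul1n => xE; have := min_i0 ne_i; rewrite -xE ltnn.
Qed.

Lemma cm_ord_addx s : cm_tangent_cone K d ->
  insg d s -> ord d (x0 + s) = (ord d s).+1.
Proof.
move=> cmA Ss; apply/eqP; rewrite eq_sym eqn_leq.
have x0d : x0 \in d by exact: mem_nth.
have Sx0 : insg d x0 by apply/insgP => //; exists 1%N; apply: sum_of1.
have ord_x0 : ord d x0 = 1%N by rewrite -[RHS](ord_min 1) mul1n.
rewrite -{1}[(ord d s).+1]add1n -{1}ord_x0 leq_ordD //= leqNgt; apply/negP => lt_ord.
have [e [eE we]] := sum_of_multinom (sum_of_ord Ss).
pose G c := mdeg c = ord d (weight c).
have Ge : G e by rewrite /G we.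
(* By [lt_ord], e with x0 added is not a longest factorization, so nothing containing it is. *)
have nGx c : ~ G (e + (c + U_(i0)))%MM.
  rewrite addmA (addmC e) -addmA => /mdeg_eq_ord_sub.
  rewrite mdegD mdeg1 weightD weight1 we eE => e1; move: lt_ord.
  by rewrite addnC -e1 addn1 ltnn.
(* A monomial that is nonzero in the tangent cone while every variable kills it. Otherwise c could
   grow forever. *)
have [c Gc maxc] : exists2 c, G (e + c)%MM & forall i, ~ G (e + c + U_(i))%MM.
  apply: contrapT => nex.
  have ex_c k : exists2 c, mdeg c = k & G (e + c)%MM.
    elim: k => [|k [c ck Gc]]; first by exists 0%MM; rewrite ?mdeg0 ?addm0.
    apply: contrapT => nk; apply: nex; exists c => // i Gci; apply: nk.
    by exists (c + U_(i))%MM; rewrite ?addmA // mdegD mdeg1 ck addn1.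
  have [c ck Gc] := ex_c (r * x0).+1.
  (* The exponent of c at i0 is 0 by [nGx], and the others are below x0 by [maximal_fact_bound]. *)
  suff : (mdeg c <= r * x0)%N by rewrite ck ltnn.
  rewrite mdegE -[r in (r * _)%N]card_ord -sum_nat_const; apply: leq_sum => i _.
  have [->|ne_i] := eqVneq i i0; last first.
    exact/ltnW/maximal_fact_bound/ne_i/(mdeg_eq_ord_sub Gc).
  have [->//|ci] := eqVneq (c i0) 0%N; case: (nGx (c - U_(i0))%MM).
  by rewrite submK // lep1mP.
set y := (e + c)%MM in Gc maxc.
have Ty i m : T 'X_[y + (U_(i) + m)].
  rewrite addmA mpolyXD mulrC; have [_ _] := T_ideal; apply.
  apply: tangent_cone_monomial; rewrite ltn_neqAle mdeg_leq_ord andbT.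
  exact/eqP/maxc.
have My f : f@_0%MM = 0 -> T (f * 'X_[y]).
  move=> f0; rewrite [f]mpolyE mulr_suml big_seq; have [T0 TD TM] := T_ideal.
  apply: (big_ind T) => // m mf; rewrite -mul_mpolyC -mulrA; apply: TM.
  have [i mi] : exists i, m i != 0%N.
    apply: contrapT => nex; move: mf; rewrite mcoeff_msupp => /negP[].
    rewrite (_ : m = 0%MM) ?f0 //; apply/mnmP => i; rewrite mnm0E.
    by apply: contrapT => /eqP mi; apply: nex; exists i.
  have := Ty i (m - U_(i))%MM.
  by rewrite (addmC U_(i)%MM) submK ?lep1mP // addmC mpolyXD.
(* The annihilator of the class of ['X_[y]] is exactly [tc_max]. *)
apply: (cm_not_annihilator tc_max_prime tc_nil_prime tc_nil_proper
  tc_max_maximal cmA).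
exists (to_tc 'X_[y]) => u; have [f ->] := to_tc_surj u.
rewrite tc_maxE -to_tcM; have -> : 0 = to_tc 0 by [].
rewrite to_tcE subr0; split=> [Tfy|/My//].
(* Removing the part of f without constant term puts a nonzero multiple of ['X_[y]] in T, although
   its [gr_coef] at the weight of y is nonzero. *)
apply/eqP; apply: contraT => f0.
have T0y : T (f@_0%MM *: 'X_[y]).
  have /My Ty0 : (f - (f@_0%MM)%:MP)@_0%MM = 0.
    by rewrite mcoeffB mcoeffC eqxx mulr1 subrr.
  have := is_idealB T_ideal Tfy Ty0.
  by rewrite mulrBl opprB addrCA subrr addr0 mul_mpolyC.
have /eqP := gr_coef_tangent_cone (weight y) T0y.
rewrite gr_coefZ gr_coefX /maximal_fact eqxx -[ord _ _]Gc eqxx mulr1.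
by rewrite (negPf f0).
Qed.
End TangentConeMonomials.

Theorem theorem3p1 (K : closedFieldType) (m n : seq nat) (p q : nat) :
  min_generated_numsgp m -> sorted ltn m ->
  min_generated_numsgp n -> sorted ltn n ->
  is_nice_gluing p q m n ->
  nondecreasing_hilbert (psring K m) ->
  cm_tangent_cone K n ->
  nondecreasing_hilbert (psring K (glue p q m n)).
Proof.
move=> [m_gt0 _ _] _ [n_gt0 gcd_n _] n_sorted.
move=> [[_ _ /andP[p_gt0 q_gt0] co_pq _] [b [a [pE qE le_ab]]]] Hm cm_n.
(* The gcd of an empty list is 0, not 1. *)
have n0 : (0 < size n)%N.
  by rewrite lt0n; apply: contra_eq_neq gcd_n => /size0nil->; rewrite big_nil.
have min_n i : i != Ordinal n0 -> (nth 0 n 0 < nth 0 n i)%N.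
  by move=> ne_i; rewrite (sorted_ltn_nth ltn_trans) ?inE // lt0n.
have sum_p : sum_of m (\sum_j b j)%N p by rewrite pE; apply: sum_of_lincomb.
have Hord v : insg n v -> ord n (nth 0%N n 0 + v)%N = (ord n v).+1.
  exact: (cm_ord_addx (i0 := Ordinal n0) n_gt0 min_n cm_n).
move=> k; rewrite !hilbert_function_psring ?glue_gt0 //.
apply: (size_level_glue_nondecreasing m_gt0 n_gt0 p_gt0 q_gt0 co_pq sum_p
  (mem_nth 0%N n0) qE le_ab Hord) => j.
by rewrite -!(hilbert_function_psring K m_gt0).
Qed.
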